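(* Let $d\in\mathbb{N}$, let $V:\mathbb{Z}^d\to\mathbb{R}$, and let $H_V=-\Delta+V$ be the discrete Schrödinger operator on $\ell^2(\mathbb{Z}^d)$. Let $\inf\sigma(H_V)=\inf\sigma_{\mathrm{ess}}(H_V)=0$ and let $H_V$ be critical at $0$ (from below). If there exist $s\in\mathbb{N}_0$ and $\varepsilon>0$ such that $$V_n\geq\frac{d(4-d)}{4|n|^2}+\frac{1}{|n|^2}\sum_{j=1}^{s}\prod_{k=1}^{j}\frac{1}{\log_k|n|}+\frac{\varepsilon}{|n|^2}\prod_{k=1}^{s}\frac{1}{\log_k|n|}$$ for all $n\in\mathbb{Z}^d$ with $|n|$ sufficiently large, then $0\in\sigma_{\mathrm{p}}(H_V)$.
   Context: The discrete Laplacian is $(-\Delta\psi)_n:=\sum_{m\in\mathbb{Z}^d,\,|m-n|=1}(\psi_n-\psi_m)$ for $\psi:\mathbb{Z}^d\to\mathbb{C}$, $n\in\mathbb{Z}^d$, where $|\cdot|$ is the Euclidean norm; it is a bounded self-adjoint operator on $\ell^2(\mathbb{Z}^d)$. A potential $V:\mathbb{Z}^d\to\mathbb{R}$ is identified with the multiplication operator $(V\psi)_n=V_n\psi_n$ on its maximal domain $\{\psi\in\ell^2(\mathbb{Z}^d): V\psi\in\ell^2(\mathbb{Z}^d)\}$, and $H_V:=-\Delta+V$ is self-adjoint on this domain. $\sigma(H)$, $\sigma_{\mathrm{p}}(H)$, $\sigma_{\mathrm{ess}}(H)$ denote the spectrum, the point spectrum (set of eigenvalues) and the essential spectrum. If $H_V$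 is bounded from below and $s_-:=\inf\sigma(H_V)$, then $H_V$ is called critical at $s_-$ (from below) if for every compact multiplication operator $W\geq0$ (by a function $W:\mathbb{Z}^d\to\mathbb{R}$), $\inf\sigma(H_V-W)=s_-$ implies $W=0$. Iterated logarithms: $\log_0x:=x$ and $\log_{k}x:=\log(\log_{k-1}x)$ for $k\in\mathbb{N}$ ($x$ large enough). Empty sums equal $0$ and empty products equal $1$. $\mathbb{N}=\{1,2,\dots\}$, $\mathbb{N}_0=\mathbb{N}\cup\{0\}$. *)

(* Defs.v *)
(* MathComp-Analysis, over an arbitrary realType R; the scalars are R[i]. *)
From mathcomp Require Import all_boot all_order all_algebra.
From mathcomp Require Import all_classical all_reals all_analysis.
From mathcomp Require Export complex.

Set Implicit Arguments.
Unset Strict Implicit.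
Unset Printing Implicit Defensive.

Import Order.TTheory GRing.Theory Num.Theory numFieldNormedType.Exports.

Local Open Scope classical_set_scope.
Local Open Scope complex_scope.
Local Open Scope ring_scope.

Notation lattice d := ('rV[int]_d).

Definition enorm (R : realType) (d : nat) (n : lattice d) : R :=
  Num.sqrt (\sum_(i < d) (n ord0 i)%:~R ^+ 2).
Arguments enorm R {d} n.

Section Operators.
Variables (R : realType) (d : nat).

Definition wave : Type := lattice d -> R[i].

Definition sqsum (psi : wave) : \bar R :=
  \esum_(n in [set: lattice d]) (Normc.normc (psi n) ^+ 2)%:E.

Definition l2 : set wave := [set psi | (sqsum psi < +oo)%E].

(* Only meaningful on l2: [fine] sends +oo to 0. *)
Definition l2norm (psi : wave) : R := Num.sqrt (fine (sqsum psi)).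

(* An operator in l2, possibly unbounded, with domain [dom]; the values of
   [act] outside [dom] play no role. *)
Record operator := Operator { dom : set wave; act : wave -> wave }.

Definition op_add (A B : operator) : operator :=
  Operator (dom A `&` dom B) (fun psi n => act A psi n + act B psi n).

Definition op_sub (A B : operator) : operator :=
  Operator (dom A `&` dom B) (fun psi n => act A psi n - act B psi n).

(* The operator -Delta. The index set is finite, so that the finitely
   supported sum is the actual sum. *)
Definition laplacian : operator :=
  Operator l2 (fun psi n =>
    \sum_(m \in [set m : lattice d | enorm R (m - n) = 1]) (psi n - psi m)).

Definition potential_mul (V : lattice d -> R) (psi : wave) : wave :=
  fun n => (V n)%:C * psi n.

Definition potential_op (V : lattice d -> R) : operator :=
  Operator [set psi | l2 psi /\ l2 (potential_mul V psi)] (potential_mul V).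

Definition schroedinger (V : lattice d -> R) : operator :=
  op_add laplacian (potential_op V).

Definition shifted (A : operator) (z : R[i]) (psi : wave) : wave :=
  fun n => act A psi n - z * psi n.

Definition resolvent_set (A : operator) : set R[i] :=
  [set z | set_bij (dom A) l2 (shifted A z) /\
           exists K : R, forall psi, dom A psi ->
             l2norm psi <= K * l2norm (shifted A z psi)].

Definition spectrum (A : operator) : set R[i] := ~` resolvent_set A.

Definition op_eigenspace (A : operator) (z : R[i]) : set wave :=
  [set psi | dom A psi /\ forall n, act A psi n = z * psi n].

Definition point_spectrum (A : operator) : set R[i] :=
  [set z | exists psi, op_eigenspace A z psi /\ psi <> (fun=> 0)].

Definition finite_multiplicity (A : operator) (z : R[i]) : Prop :=
  exists (N : nat) (e : 'I_N -> wave), forall psi, op_eigenspace A z psi ->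
    exists c : 'I_N -> R[i], forall n, psi n = \sum_(j < N) c j * e j n.

(* Isolated points of the spectrum that are eigenvalues of finite
   multiplicity. *)
Definition discrete_spectrum (A : operator) : set R[i] :=
  [set z | [/\ isolated (spectrum A : set R[i]^o) z,
               point_spectrum A z & finite_multiplicity A z]].

(* The essential spectrum of a self-adjoint operator. *)
Definition essential_spectrum (A : operator) : set R[i] :=
  spectrum A `\` discrete_spectrum A.

(* Infimum of the real points of S (all of S if S is the spectrum of a
   self-adjoint operator), with value +oo if there are none and -oo if they
   are not bounded from below. *)
Definition real_inf (S : set R[i]) : \bar R :=
  ereal_inf [set x%:E | x in [set x : R | S x%:C]].

Definition compact_operator (A : operator) : Prop :=
  dom A = l2 /\
  forall u : nat -> wave,
    (forall k, l2 (u k)) -> (exists M : R, forall k, l2norm (u k) <= M) ->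
    exists (phi : nat -> nat) (v : wave),
      [/\ {homo phi : i j / (i < j)%N}, l2 v &
          (fun k => l2norm (fun n => act A (u (phi k)) n - v n)) @ \oo --> (0 : R)].

(* As s is a real number, the first conjunct contains the boundedness from
   below of the self-adjoint operator -Delta + V. *)
Definition critical_at (V : lattice d -> R) (s : R) : Prop :=
  real_inf (spectrum (schroedinger V)) = s%:E /\
  forall W : lattice d -> R,
    compact_operator (potential_op W) -> (forall n, 0 <= W n) ->
    real_inf (spectrum (op_sub (schroedinger V) (potential_op W))) = s%:E ->
    forall n, W n = 0.

End Operators.

(* Junk values (ln x = 0 for x <= 0) only occur for x not large. *)
Definition iter_log (R : realType) (k : nat) (x : R) : R := iter k (@ln R) x.

(* Main.v *)
(* By criticality, the quadratic form of H_V is nonnegative, but that of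
   H_V - t delta_0 is not, for any t > 0. Hence the Green functions
   g_N = (H_V + 1/N)^(-1) delta_0 on the boxes |n_i| <= N are nonnegative, with
   g_N(0) -> oo. The lower bound on V makes
     phi(n) = |n|^(-d/2) (log_1 |n| ... log_s |n|)^(-1/2) (log_s |n|)^(-delta/2)
   with small delta > 0 a square-summable positive supersolution outside a
   ball. Normalized to have sum 1 over that ball, the g_N are dominated by a
   multiple of phi uniformly in N, by the maximum principle for g_N / phi;
   a pointwise limit is a nonzero element of l^2 annihilated by H_V.

   The lower bounds of the form and of the spectrum agree: if the form is
   >= e, then Dirichlet problems on boxes yield the resolvent at every
   lambda < e, and if moreover e is in the resolvent set, then the form is
   >= e + 1/K with K a bound for the resolvent at e.

   That phi is a supersolution follows from the expansion of
   phi(m) / phi(n), m a neighbour of n, up to O(z^4), with |m|^2 = |n|^2 (1 + z)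
   and z = (1 + 2 n_i) / |n|^2 or (1 - 2 n_i) / |n|^2: the odd powers of z
   almost cancel in the sum over m. *)
Require Import Defs.
From mathcomp Require Import all_boot all_order all_algebra.
From mathcomp Require Import all_classical all_reals all_analysis.
From mathcomp Require Import zify ring lra.

Set Implicit Arguments.
Unset Strict Implicit.
Unset Printing Implicit Defensive.

Import Order.TTheory GRing.Theory Num.Theory numFieldNormedType.Exports.

Local Open Scope classical_set_scope.
Local Open Scope ring_scope.

(** * Third-order expansions *)

(** The exponents in [phi] are squeezed from two sides. With [delta = 0], [phi^2] would be the
    borderline divergent [|n|^(-d) / (log_1 |n| ... log_s |n|)]; the factor [(log_s |n|)^(-delta)]
    makes the sums over shells telescope. On the other side, [phi] is, up to errors, a supersolution
    for the bound of the theorem with [delta] in place of [eps], so the margin [eps - delta] has to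
    absorb the errors. No spectral calculus is used. [H_V] has real coefficients, hence acts on real
    and imaginary parts separately, and all estimates concern real functions on finite boxes. The
    passage to [l^2] costs only the bonds that cross the boundary of a box, which the tail of a
    square-summable function controls. [V] is bounded below because [phi] is positive with
    [H_V phi >= 0] outside a box; the form therefore has some lower bound before any spectral
    information enters. *)

Section Jets.
Variable R : realType.
Implicit Types (f : R -> R) (g : R -> R -> R) (a b : R -> R).

(** The mean value theorem between 0 and [u] gains one power of [u] and keeps the constant [C].
    Iterated, it turns a bound on a high derivative into a bound on a Taylor remainder. *)
Lemma mean_value_bound f (f' : R -> R) (r C : R) (k : nat) :
  (forall v : R, `|v| <= r -> is_derive v 1 f (f' v)) -> f 0 = 0 ->
  (forall v, `|v| <= r -> `|f' v| <= C * `|v| ^+ k) ->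
  forall u, `|u| <= r -> `|f u| <= C * `|u| ^+ k.+1.
Proof.
move=> df f0 bf' u ur.
have sub (c : R) : `|c| <= `|u| -> `|c| <= r by move=> h; exact: le_trans h ur.
have main (c : R) : `|c| <= `|u| -> f u = f' c * u -> `|f u| <= C * `|u| ^+ k.+1.
  move=> cu ->; rewrite normrM exprSr mulrA ler_wpM2r //.
  apply: le_trans (bf' c (sub _ cu)) _.
  have C0 : 0 <= C * `|c| ^+ k by apply: le_trans (bf' c (sub _ cu)).
  (* [C] is not assumed nonnegative: for nonzero [c] its sign follows from [C0]. *)
  have [->|c0] := eqVneq c 0; last first.
    have ck : 0 < `|c| ^+ k by rewrite exprn_gt0 // normr_gt0.
    by rewrite ler_wpM2l -?(pmulr_lge0 C ck) // lerXn2r.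
  case: (k) (bf' u ur) => [|j] h; first by rewrite !expr0.
  by rewrite normr0 exprS mul0r mulr0; apply: le_trans h.
have [u0|u0|u0] := ltgtP u 0.
- have [c cI e] : exists2 c, c \in `[u, 0]%R & f 0 - f u = f' c * (0 - u).
    apply: MVT_segment => [|x|]; first exact: ltW.
      rewrite in_itv /= => /andP[ux x0]; apply: df; apply: sub.
      by rewrite !ltr0_norm // lerN2 ltW.
    apply: derivable_within_continuous => x; rewrite in_itv /= => /andP[ux x0].
    apply: ex_derive; apply: df; apply: sub.
    by rewrite ler0_norm // ltr0_norm // lerN2.
  move: cI; rewrite in_itv /= => /andP[uc c0].
  apply: (main c); first by rewrite ler0_norm // ltr0_norm // lerN2.
  by move: e; rewrite f0 !sub0r mulrN => /oppr_inj.
- have [c cI e] : exists2 c, c \in `[0, u]%R & f u - f 0 = f' c * (u - 0).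
    apply: MVT_segment => [|x|]; first exact: ltW.
      rewrite in_itv /= => /andP[ux x0]; apply: df; apply: sub.
      by rewrite !gtr0_norm // ltW.
    apply: derivable_within_continuous => x; rewrite in_itv /= => /andP[ux x0].
    apply: ex_derive; apply: df; apply: sub.
    by rewrite ger0_norm // gtr0_norm.
  move: cI; rewrite in_itv /= => /andP[uc c0].
  apply: (main c); first by rewrite ger0_norm // gtr0_norm.
  by move: e; rewrite f0 !subr0.
- by apply: (main 0); rewrite ?normr0 // u0 f0 mulr0.
Qed.

(** Normalized to value 0 and slope 1 at 0, as fits both outer functions of the compositions below,
    [exp - 1] and [log (1 + .)]. *)
Definition taylor3 f (f2 : R) := exists f3 K r : R, 0 < r /\
  forall u, `|u| <= r -> exists2 q : R, `|q| <= K &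
    f u = u + f2 * u ^+ 2 + f3 * u ^+ 3 + q * u ^+ 4.

Lemma taylor3I f (f2 f3 K r : R) : 0 < r -> 0 <= K ->
  (forall u, `|u| <= r ->
    `|f u - (u + f2 * u ^+ 2 + f3 * u ^+ 3)| <= K * `|u| ^+ 4) ->
  taylor3 f f2.
Proof.
move=> r0 K0 H; exists f3, K, r; split=> // u /H {}H.
have [u0|u0] := eqVneq u 0.
  exists 0; first by rewrite normr0.
  apply/eqP; rewrite mul0r addr0 -subr_eq0 -normr_le0.
  by apply: le_trans H _; rewrite u0 normr0 expr0n mulr0.
exists ((f u - (u + f2 * u ^+ 2 + f3 * u ^+ 3)) / u ^+ 4); last by field.
by rewrite normrM normfV normrX ler_pdivrMr // exprn_gt0 ?normr_gt0.
Qed.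

(** The functions [t1], ..., [t4] vanish at 0 and each has its predecessor as derivative, so
    [mean_value_bound] climbs from the bound [expR 1] on [t0] to the remainder [t4]. *)
Lemma taylor3_expm1 : taylor3 (fun u : R => expR u - 1) 2^-1.
Proof.
pose t0 := (@expR R); pose t1 u := expR u - 1 : R.
pose t2 (u : R) := expR u - 1 - u : R.
pose t3 (u : R) := expR u - 1 - u - 2^-1 * u ^+ 2 : R.
pose t4 (u : R) := expR u - 1 - u - 2^-1 * u ^+ 2 - 6^-1 * u ^+ 3 : R.
have b0 (v : R) : `|v| <= 1 -> `|t0 v| <= expR 1 * `|v| ^+ 0.
  move=> v1; rewrite mulr1 /t0 ger0_norm ?expR_ge0 // ler_expR.
  exact: le_trans (ler_norm _) v1.
have b1 := @mean_value_bound t1 t0 1 (expR 1) 0 _ _ b0.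
have {}b1 : forall u, `|u| <= 1 -> `|t1 u| <= expR 1 * `|u| ^+ 1.
  apply: b1; last by rewrite /t1 expR0 subrr.
  by move=> v _; rewrite /t1 /t0; apply: is_derive_eq; rewrite subr0.
have b2 := @mean_value_bound t2 t1 1 (expR 1) 1 _ _ b1.
have {}b2 : forall u, `|u| <= 1 -> `|t2 u| <= expR 1 * `|u| ^+ 2.
  apply: b2; last by rewrite /t2 expR0 subrr subr0.
  by move=> v _; rewrite /t2 /t1; apply: is_derive_eq; rewrite subr0.
have b3 := @mean_value_bound t3 t2 1 (expR 1) 2 _ _ b2.
have {}b3 : forall u, `|u| <= 1 -> `|t3 u| <= expR 1 * `|u| ^+ 3.
  apply: b3; last by rewrite /t3 expR0; ring.
  by move=> v _; rewrite /t3 /t2; apply: is_derive_eq; rewrite /GRing.scale /=; field.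
have b4 := @mean_value_bound t4 t3 1 (expR 1) 3 _ _ b3.
have {}b4 : forall u, `|u| <= 1 -> `|t4 u| <= expR 1 * `|u| ^+ 4.
  apply: b4; last by rewrite /t4 expR0; ring.
  by move=> v _; rewrite /t4 /t3; apply: is_derive_eq; rewrite /GRing.scale /=; field.
apply: (@taylor3I _ _ 6^-1 (expR 1) 1) => // u /b4.
by rewrite /t4 !opprD !addrA.
Qed.

(** The derivative of the remainder is the tail [- u^3 / (1 + u)] of a geometric series, so a single
    use of [mean_value_bound] suffices. *)
Lemma taylor3_ln1p : taylor3 (fun u : R => ln (1 + u)) (- 2^-1).
Proof.
pose t (u : R) := ln (1 + u) - (u + - 2^-1 * u ^+ 2 + 3^-1 * u ^+ 3).
pose t' (u : R) := - u ^+ 3 / (1 + u).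
have pos (v : R) : `|v| <= 2^-1 -> 2^-1 <= 1 + v.
  by rewrite ler_norml => /andP[]; lra.
have H := @mean_value_bound t t' 2^-1 2 3.
apply: (@taylor3I _ _ 3^-1 2 2^-1) => // u; apply: H => [v /pos vp||v /pos vp].
- have v1 : 0 < 1 + v by lra.
  have dl : is_derive (1 + v) 1 (@ln R) (1 + v)^-1 by exact: is_derive1_ln.
  rewrite /t /t'; apply: is_derive_eq; rewrite /GRing.scale /=; field; lra.
- by rewrite /t addr0 ln1 !(expr0n, mulr0, addr0, subr0).
- have v1 : 0 < 1 + v by lra.
  rewrite /t' normrM normrN normrX normfV mulrC ler_wpM2r // ?exprn_ge0 //.
  by rewrite (gtr0_norm v1) -[leRHS]invrK lef_pV2 // ?posrE; lra.
Qed.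

(* For large x, g x z = a x z + b x z^2 + c z^3 + O(z^4) uniformly in x, with c
   independent of z. The value of c is not recorded: the contributions of z^3
   nearly cancel in the sum over opposite neighbours. *)
Definition jet g a b := exists M r : R, 0 < r /\
  \forall x \near +oo, [/\ `|a x| <= M, `|b x| <= M &
    exists2 c : R, `|c| <= M & forall z, `|z| <= r -> exists2 q : R, `|q| <= M &
      g x z = a x * z + b x * z ^+ 2 + c * z ^+ 3 + q * z ^+ 4].

Lemma jet_eq g a b g' a' b' : jet g a b ->
  (\forall x \near +oo, [/\ a x = a' x, b x = b' x & g x =1 g' x]) ->
  jet g' a' b'.
Proof.
move=> [M [r [r0 h]]] e; exists M, r; split => //.
near=> x; have [] := near h x => //.
have [] := near e x => // -> -> gg aM bM [c cM H]; split=> //.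
by exists c => // z /H[q qM e']; exists q; rewrite -?gg.
Unshelve. all: by end_near. Qed.

Lemma jetD g1 a1 b1 g2 a2 b2 : jet g1 a1 b1 -> jet g2 a2 b2 ->
  jet (fun x z => g1 x z + g2 x z) (fun x => a1 x + a2 x) (fun x => b1 x + b2 x).
Proof.
move=> [M [r [r0 h]]] [M' [r' [r0' h']]].
exists (M + M'), (Num.min r r'); split; first by rewrite lt_min r0.
near=> x; have [] := near h x => //; have [] := near h' x => //.
move=> a2M b2M [c2 c2M H2] a1M b1M [c1 c1M H1].
have ad (u v : R) : `|u| <= M -> `|v| <= M' -> `|u + v| <= M + M'.
  by move=> uM vM; apply: le_trans (ler_normD _ _) _; rewrite lerD.
split; [exact: ad|exact: ad|]; exists (c1 + c2); first exact: ad.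
move=> z; rewrite le_min => /andP[/H1[q1 q1M ->] /H2[q2 q2M ->]].
by exists (q1 + q2); [exact: ad|ring].
Unshelve. all: by end_near. Qed.

Lemma jetM g1 a1 b1 g2 a2 b2 : jet g1 a1 b1 -> jet g2 a2 b2 ->
  jet (fun x z => g1 x z * g2 x z) (fun=> 0) (fun x => a1 x * a2 x).
Proof.
move=> [M [r [r0 h]]] [M' [r' [r0' h']]].
(* There are 16 products of a coefficient of one factor with one of the other; [|z| <= 1] lets all
   powers above the fourth be absorbed into [q]. *)
exists (16 * (`|M| * `|M'|)), (Num.min 1 (Num.min r r')).
split; first by rewrite !lt_min r0 ltr01.
near=> x; have [] := near h x => //; have [] := near h' x => //.
move=> a2M b2M [c2 c2M H2] a1M b1M [c1 c1M H1].
have M0 : 0 <= `|M| * `|M'| by rewrite mulr_ge0.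
have mu (u v : R) : `|u| <= M -> `|v| <= M' -> `|u * v| <= `|M| * `|M'|.
  move=> uM vM; rewrite normrM ler_pM //.
    exact: le_trans uM (ler_norm _).
  exact: le_trans vM (ler_norm _).
split; first by rewrite normr0 mulr_ge0.
  by apply: le_trans (mu _ _ a1M a2M) _; lra.
exists (a1 x * b2 x + b1 x * a2 x).
  apply: le_trans (ler_normD _ _) _.
  by have := mu _ _ a1M b2M; have := mu _ _ b1M a2M; lra.
move=> z; rewrite !le_min => /andP[z1 /andP[/H1[q1 q1M ->] /H2[q2 q2M ->]]].
pose A := `|M| * `|M'|.
exists ((a1 x * c2 + b1 x * b2 x + c1 * a2 x)
  + z * (a1 x * q2 + b1 x * c2 + c1 * b2 x + q1 * a2 x
  + z * (b1 x * q2 + c1 * c2 + q1 * b2 x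
  + z * (c1 * q2 + q1 * c2 + z * (q1 * q2))))); last by rewrite /=; ring.
have zm (u B : R) : `|u| <= B -> `|z * u| <= B.
  by move=> uB; rewrite normrM; apply: le_trans uB; rewrite ler_piMl.
have ad (u v B C : R) : `|u| <= B -> `|v| <= C -> `|u + v| <= B + C.
  by move=> uM vM; apply: le_trans (ler_normD _ _) _; rewrite lerD.
apply: (@le_trans _ _
  (A + A + A + (A + A + A + A + (A + A + A + (A + A + A))))); last first.
  by rewrite -/A in M0 *; lra.
by do !first [exact: mu | apply: (ad) | apply: (zm)].
Unshelve. all: by end_near. Qed.

Lemma jetZ (k : R -> R) g a b (B : R) : (\forall x \near +oo, `|k x| <= B) ->
  jet g a b -> jet (fun x z => k x * g x z) (fun x => k x * a x) (fun x => k x * b x).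
Proof.
move=> kB [M [r [r0 h]]]; exists (B * M), r; split => //.
near=> x; have [] := near h x => // aM bM [c cM H].
have kx : `|k x| <= B by near: x.
have mu (v : R) : `|v| <= M -> `|k x * v| <= B * M by move=> vM; rewrite normrM ler_pM.
split; [exact: mu|exact: mu|]; exists (k x * c); first exact: mu.
by move=> z /H[q qM ->]; exists (k x * q); [exact: mu|ring].
Unshelve. all: by end_near. Qed.

Lemma jetZc (k : R) g a b :
  jet g a b -> jet (fun x z => k * g x z) (fun x => k * a x) (fun x => k * b x).
Proof. by apply: (@jetZ _ _ _ _ `|k|); near=> x. Unshelve. all: by end_near. Qed.

Lemma jet_linear g a b : jet g a b -> exists K r : R, [/\ 0 < K, 0 < r &
  \forall x \near +oo, forall z, `|z| <= r -> `|g x z| <= K * `|z|].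
Proof.
move=> [M [r [r0 h]]]; exists (4 * `|M| + 1), (Num.min 1 r).
split; [by rewrite ltr_wpDl // mulr_ge0|by rewrite lt_min ltr01|].
near=> x => z; rewrite le_min => /andP[z1 zr].
have [] := near h x => // aM bM [c cM /(_ z zr)[q qM ->]].
have -> : a x * z + b x * z ^+ 2 + c * z ^+ 3 + q * z ^+ 4 =
  (a x + z * (b x + z * (c + z * q))) * z by ring.
rewrite normrM ler_wpM2r //.
apply: (@le_trans _ _ (M + (M + (M + M)))); last by have := ler_norm M; lra.
have zm (u B : R) : `|u| <= B -> `|z * u| <= B.
  by move=> uB; rewrite normrM; apply: le_trans uB; rewrite ler_piMl.
have ad (u v B C : R) : `|u| <= B -> `|v| <= C -> `|u + v| <= B + C.
  by move=> uM vM; apply: le_trans (ler_normD _ _) _; rewrite lerD.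
by do !first [assumption | apply: (ad) | apply: (zm)].
Unshelve. all: by end_near. Qed.

(** The cubic Taylor polynomial of [f] at [g x z] is a jet by [jetD] and [jetM]. The remainder
    [q' * (g x z)^4] is [O(z^4)] because [jet_linear] bounds [g x z / z], and the same bound keeps
    [g x z] within the radius of [f]. *)
Lemma jet_comp f (f2 : R) g a b : taylor3 f f2 -> jet g a b ->
  jet (fun x z => f (g x z)) a (fun x => b x + f2 * a x ^+ 2).
Proof.
move=> [f3 [K [rf [rf0 Hf]]]] jg.
have [M' [r' [M'0 r'0 h']]] := jet_linear jg.
pose g' x z := g x z + f2 * (g x z * g x z) + f3 * (g x z * (g x z * g x z)).
have : jet g' (fun x => a x + f2 * 0 + f3 * 0)
              (fun x => b x + f2 * (a x * a x) + f3 * (a x * 0)).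
  apply: jetD; first apply: jetD => //; apply: jetZc.
    exact: (jetM jg jg).
  exact: (jetM jg (jetM jg jg)).
move=> [M [r [r0 h]]].
exists (M + K * M' ^+ 4), (Num.min r (Num.min r' (rf / M'))).
split; first by rewrite !lt_min r0 r'0 divr_gt0.
near=> x; have [] := near h x => //= aM bM [c cM H].
have KM (q : R) : `|q| <= K -> 0 <= K * M' ^+ 4.
  by move=> qK; rewrite mulr_ge0 ?exprn_ge0 ?(le_trans _ qK) // ltW.
have [q0 q0K _] : exists2 q : R, `|q| <= K & f 0 = 0 + f2 * 0 ^+ 2 + f3 * 0 ^+ 3 + q * 0 ^+ 4.
  by apply: Hf; rewrite normr0 ltW.
have K0 := KM _ q0K.
split; [by move: aM; rewrite !mulr0 !addr0; lra|by move: bM; rewrite !mulr0 addr0 expr2; lra|].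
exists c; first lra.
move=> z; rewrite !le_min => /and3P[zr zr' zrf].
have [q qM e] := H z zr.
have gz : `|g x z| <= M' * `|z| by apply: (near h' x) => //.
have [|q' q'K ->] := Hf (g x z).
  by apply: le_trans gz _; rewrite mulrC -ler_pdivlMr.
have [z0|z0] := eqVneq z 0.
  have g0 : g x z = 0.
    by apply/eqP; rewrite -normr_le0; apply: le_trans gz _; rewrite z0 normr0 mulr0.
  by exists 0; [rewrite normr0; have := normr_ge0 q; lra|rewrite g0 z0; ring].
exists (q + q' * (g x z / z) ^+ 4).
  apply: le_trans (ler_normD _ _) _; rewrite lerD // normrM ler_pM // normrX.
  have gM : `|g x z / z| <= M'.
    by rewrite normrM normfV ler_pdivrMr ?normr_gt0.
  by rewrite lerXn2r ?nnegrE // ltW.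
have -> : g x z + f2 * g x z ^+ 2 + f3 * g x z ^+ 3 = g' x z by rewrite /g'; ring.
by rewrite e; field.
Unshelve. all: by end_near. Qed.

End Jets.

(** * Iterated logarithms *)

Section IteratedLogarithms.
Variable R : realType.
Implicit Types (x z : R) (k s : nat).

Local Notation L := (@iter_log R).

Lemma iter_logS k x : L k.+1 x = ln (L k x).
Proof. by []. Qed.

Lemma iter_log_large (M : R) k : \forall x \near +oo, M <= L k x.
Proof.
elim: k M => [|k IH] M; first exact: (nbhs_pinfty_ge (num_real _)).
near=> x; rewrite iter_logS -[leLHS]expRK ler_ln ?posrE ?expR_gt0 //.
  by near: x; exact: IH.
by apply: (@lt_le_trans _ _ 1) => //; near: x; exact: IH.
Unshelve. all: by end_near. Qed.

(** For large [x], [log_prod s x / x] is the derivative of [L s.+1] at [x]. *)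
Definition log_prod s x := \prod_(1 <= k < s.+1) (1 / L k x).

Lemma log_prod0 x : log_prod 0 x = 1.
Proof. by rewrite /log_prod big_geq. Qed.

Lemma log_prodS s x : log_prod s.+1 x = log_prod s x / L s.+1 x.
Proof. by rewrite /log_prod big_nat_recr //= mul1r. Qed.

Lemma log_prod_bounds k : \forall x \near +oo, 0 < log_prod k x <= 1.
Proof.
elim: k => [|k IH]; first by near=> x; rewrite log_prod0 ltr01 lexx.
near=> x; have /andP[p0 p1] : 0 < log_prod k x <= 1 by near: x.
have L1 : 1 <= L k.+1 x by near: x; exact: iter_log_large.
rewrite log_prodS divr_gt0 ?(lt_le_trans _ L1) //= ler_pdivrMr ?(lt_le_trans _ L1) //.
by rewrite mul1r (le_trans p1).
Unshelve. all: by end_near. Qed.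

Lemma log_prod_le1 k : \forall x \near +oo, log_prod k.+1 x <= log_prod 1 x.
Proof.
elim: k => [|k IH]; first by near=> x.
near=> x; have /andP[p0 p1] : 0 < log_prod k.+1 x <= 1.
  by near: x; exact: log_prod_bounds.
have L1 : 1 <= L k.+2 x by near: x; exact: iter_log_large.
apply: (@le_trans _ _ (log_prod k.+1 x)); last by near: x.
by rewrite log_prodS ler_pdivrMr ?(lt_le_trans _ L1) // ler_peMr // ltW.
Unshelve. all: by end_near. Qed.

(* The increment of L_(k+1) when the argument x is multiplied by
   sqrt (1 + z). *)
Fixpoint log_incr k x z : R :=
  if k is k'.+1 then ln (1 + 1 / L k'.+1 x * log_incr k' x z)
  else 2^-1 * ln (1 + z).

(* log_incr k x z = log_prod k x / 2 * log (1 + z) - log_curv k x z^2 + O(z^3). *)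
Fixpoint log_curv k x : R :=
  if k is k'.+1 then log_curv k' x / L k'.+1 x + log_prod k'.+1 x ^+ 2 / 8
  else 0.

(** Unfolded, [log_curv k] is a sum of [k] terms, each containing the square of some [log_prod j]
    with [j >= 1]. This makes it a second-order quantity. *)
Lemma log_curv_bounds k : \forall x \near +oo,
  0 <= log_curv k x <= k%:R * log_prod 1 x ^+ 2.
Proof.
elim: k => [|k IH]; first by near=> x; rewrite mul0r lexx.
near=> x; have /andP[p0 p1] : 0 <= log_curv k x <= k%:R * log_prod 1 x ^+ 2 by near: x.
have /andP[q0 q1] : 0 < log_prod k.+1 x <= 1 by near: x; exact: log_prod_bounds.
have q2 : log_prod k.+1 x <= log_prod 1 x by near: x; exact: log_prod_le1.
have L1 : 1 <= L k.+1 x by near: x; exact: iter_log_large.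
have q3 : log_prod k.+1 x ^+ 2 <= log_prod 1 x ^+ 2.
  by rewrite lerXn2r ?nnegrE //; [exact: ltW|exact: le_trans (ltW q0) q2].
have q4 : 0 <= log_prod k.+1 x ^+ 2 by exact: sqr_ge0.
have c1 : log_curv k x / L k.+1 x <= log_curv k x.
  by rewrite ler_pdivrMr ?(lt_le_trans _ L1) // ler_peMr.
have c2 : 0 <= log_curv k x / L k.+1 x.
  by rewrite divr_ge0 // (le_trans _ L1).
by rewrite /= -[k.+1%:R]natr1 mulrDl mul1r; apply/andP; split; lra.
Unshelve. all: by end_near. Qed.

(** By [jet_comp], the outer logarithm adds [- (log_prod k.+1 x / 2)^2 / 2] to the second
    coefficient; this is the recursion of [log_curv]. *)
Lemma jet_log_incr k :
  jet (log_incr k) (fun x => log_prod k x / 2)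
    (fun x => - (log_prod k x / 4) - log_curv k x).
Proof.
elim: k => [|k IH].
  have jid : jet (fun _ z : R => z) (fun=> 1) (fun=> 0).
    exists 1, 1; split => //; near=> x; rewrite normr1 normr0; split=> //.
    exists 0; first by rewrite normr0.
    by move=> z _; exists 0; [rewrite normr0|ring].
  apply: jet_eq (jetZc 2^-1 (jet_comp (@taylor3_ln1p R) jid)) _.
  by near=> x; split=> //=; rewrite log_prod0; field.
have Lb : \forall x \near +oo, `|1 / L k.+1 x| <= 1.
  near=> x; have L1 : 1 <= L k.+1 x by near: x; exact: iter_log_large.
  rewrite ger0_norm ?divr_ge0 ?(le_trans _ L1) //.
  by rewrite ler_pdivrMr ?(lt_le_trans _ L1) // mul1r.
apply: jet_eq (jet_comp (@taylor3_ln1p R) (jetZ Lb IH)) _.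
near=> x; have L1 : 1 <= L k.+1 x by near: x; exact: iter_log_large.
by split => //=; rewrite log_prodS -iter_logS; field; lra.
Unshelve. all: by end_near. Qed.

Lemma iter_log_incr k : exists2 r : R, 0 < r & \forall x \near +oo,
  forall z, `|z| <= r ->
  L k.+1 (x * Num.sqrt (1 + z)) = L k.+1 x + log_incr k x z.
Proof.
elim: k => [|k [r r0 IH]].
  exists 2^-1 => //; near=> x => z; rewrite ler_norml => /andP[z1 z2].
  have x0 : 0 < x by [].
  have z0 : 0 < 1 + z by lra.
  rewrite /= /iter_log /= lnM ?posrE ?sqrtr_gt0 //; congr (_ + _).
  have w0 : 0 < Num.sqrt (1 + z) by rewrite sqrtr_gt0.
  by rewrite -[in RHS](sqr_sqrtr (ltW z0)) lnXn // mulr2n; field.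
have [K [r' [K0 r'0 H]]] := jet_linear (jet_log_incr k).
(* The radius [2^-1 / K] forces [|log_incr k x z| <= 1/2], so the logarithm is taken at a positive
   argument. *)
exists (Num.min r (Num.min r' (2^-1 / K))); first by rewrite !lt_min r0 r'0 divr_gt0.
near=> x => z; rewrite !le_min => /and3P[zr zr' zK].
have L1 : 1 <= L k.+1 x by near: x; exact: iter_log_large.
rewrite iter_logS (near IH x) // iter_logS /= -lnM ?posrE ?(lt_le_trans _ L1) //.
  by congr (ln _); rewrite -iter_logS; field; lra.
have g : `|log_incr k x z| <= 2^-1.
  apply: le_trans (near H x _ _ zr') _ => //.
  by rewrite mulrC -ler_pdivlMr.
have : `|1 / L k.+1 x * log_incr k x z| <= 2^-1.
  rewrite normrM; apply: le_trans g; rewrite ler_piMl //.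
  rewrite ger0_norm ?divr_ge0 ?(le_trans _ L1) //.
  by rewrite ler_pdivrMr ?(lt_le_trans _ L1) // mul1r.
by rewrite ler_norml => /andP[]; lra.
Unshelve. all: by end_near. Qed.

(** With [c = m.+1], [expR v = expR (v / c) ^+ m.+1 >= (v / c) ^+ m.+1]; the one spare factor [v]
    beats the constants. *)
Lemma expR_dominates (K : R) (m : nat) : \forall v \near +oo, K * v ^+ m <= expR v.
Proof.
pose c : R := m.+1%:R.
have c0 : 0 < c by rewrite ltr0n.
near=> v.
have v0 : 0 < v by [].
have vK : K * c ^+ m.+1 <= v by near: v; exact: (nbhs_pinfty_ge (num_real _)).
have -> : v = c * (v / c) by field; rewrite gt_eqF.
rewrite expRM_natl -/c (_ : c * (v / c) = v); last by field; rewrite gt_eqF.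
apply: (@le_trans _ _ ((v / c) ^+ m.+1)).
  rewrite expr_div_n ler_pdivlMr ?exprn_gt0 // mulrAC [v ^+ _.+1]exprS.
  by rewrite ler_wpM2r // exprn_ge0 // ltW.
rewrite lerXn2r ?nnegrE ?expR_ge0 ?divr_ge0 // ?ltW //.
by apply: lt_le_trans (expR_ge1Dx _); rewrite ltrDr.
Unshelve. all: by end_near. Qed.

(** Beyond [L 1], the denominator of [log_prod s.+1] has the [s] factors [L 2], ..., [L s.+1], none
    larger than [L 2]. *)
Lemma log_prod_ge s : \forall x \near +oo,
  (L 2 x ^+ s)^-1 * log_prod 1 x <= log_prod s.+1 x.
Proof.
elim: s => [|s IH]; first by near=> x; rewrite expr0 invr1 mul1r.
have L2 k : \forall x \near +oo, L k.+2 x <= L 2 x.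
  elim: k => [|k IHk]; first by near=> x.
  near=> x; apply: le_trans (_ : L k.+2 x <= _); last by near: x.
  rewrite [leLHS]iter_logS; apply/ltW/ln_sublinear.
  by apply: (@lt_le_trans _ _ 1) => //; near: x; exact: iter_log_large.
near=> x.
have L1 : 1 <= L 2 x by near: x; exact: iter_log_large.
have L1' : 1 <= L s.+2 x by near: x; exact: iter_log_large.
have /andP[p0 _] : 0 < log_prod 1 x <= 1 by near: x; exact: log_prod_bounds.
rewrite [log_prod s.+2 x]log_prodS exprSr invfM mulrAC ler_pM //.
- by rewrite mulr_ge0 ?invr_ge0 ?exprn_ge0 // ?(le_trans _ L1) // ltW.
- by rewrite invr_ge0 (le_trans _ L1).
- by near: x.
- by rewrite lef_pV2 ?posrE ?(lt_le_trans _ L1) ?(lt_le_trans _ L1') //; near: x; exact: L2.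
Unshelve. all: by end_near. Qed.

(** With [v = L 2 x] one has [log_prod 1 x = expR (- v)], and [log_prod_ge] reduces the claim to
    [K * v ^+ s <= expR v]: a second power of [1 / log x] is smaller than any product of further
    iterated logarithms costs. *)
Lemma log_prod_sqr_negligible (K : R) s : \forall x \near +oo,
  K * log_prod 1 x ^+ 2 <= log_prod s.+1 x.
Proof.
have [M [_ HM]] := expR_dominates K s.
near=> x.
have L1 : 1 <= L 1 x by near: x; exact: iter_log_large.
have L2 : 1 <= L 2 x by near: x; exact: iter_log_large.
apply: le_trans (_ : (L 2 x ^+ s)^-1 * log_prod 1 x <= _); last first.
  by near: x; exact: log_prod_ge.
rewrite expr2 mulrA ler_wpM2r //.
  by rewrite log_prodS log_prod0 mul1r invr_ge0 (le_trans _ L1).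
rewrite log_prodS log_prod0 mul1r.
have -> : L 1 x = expR (L 2 x) by rewrite (iter_logS 1) lnK // posrE (lt_le_trans _ L1).
rewrite ler_pdivrMr ?expR_gt0 // mulrC ler_pdivlMr ?exprn_gt0 // ?(lt_le_trans _ L2) //.
apply: HM; apply: (@lt_le_trans _ _ (M + 1)); first by rewrite ltrDl.
by near: x; exact: iter_log_large.
Unshelve. all: by end_near. Qed.
End IteratedLogarithms.

(** * The radial supersolution *)

Section RadialSupersolution.
Variables (R : realType) (d s : nat) (delta : R).
Implicit Types (x z : R).

Local Notation L := (@iter_log R).

(* x^(-d/2) (log_1 x ... log_s x)^(-1/2) (log_s x)^(-delta/2) for large x. *)
Definition radial x := expR (- (d%:R / 2 * L 1 x
  + 2^-1 * \sum_(1 <= k < s.+1) L k.+1 x + delta / 2 * L s.+1 x)).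

(** The logarithm of [radial (x * sqrt (1 + z)) / radial x], written as a linear combination to
    which [jetD] and [jetZc] apply. *)
Definition radial_incr x z := - (d%:R / 2) * log_incr 0 x z
  + (- 2^-1) * \sum_(1 <= k < s.+1) log_incr k x z
  + (- (delta / 2)) * log_incr s x z.

(** For large [x], [- (d + log_sum x) / 2] is [x] times the logarithmic derivative of [radial] at
    [x]. *)
Definition log_sum x := \sum_(1 <= j < s.+1) log_prod j x + delta * log_prod s x.

Definition curv_sum x :=
  2^-1 * \sum_(1 <= j < s.+1) log_curv j x + delta / 2 * log_curv s x.

Lemma radial_mul_sqrt : exists2 r : R, 0 < r & \forall x \near +oo,
  forall z, `|z| <= r ->
  radial (x * Num.sqrt (1 + z)) = radial x * expR (radial_incr x z).
Proof.
have [r r0 H] : exists2 r : R, 0 < r & \forall x \near +oo, forall z, `|z| <= r ->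
    \sum_(1 <= k < s.+1) L k.+1 (x * Num.sqrt (1 + z)) =
    \sum_(1 <= k < s.+1) L k.+1 x + \sum_(1 <= k < s.+1) log_incr k x z.
  elim: s => [|n [r r0 IH]].
    by exists 1 => //; near=> x => z _; rewrite !big_geq // addr0.
  have [r' r'0 H] := iter_log_incr R n.+1.
  exists (Num.min r r'); first by rewrite lt_min r0.
  near=> x => z; rewrite le_min => /andP[zr zr'].
  rewrite !(@big_nat_recr _ _ _ n.+1) // (near IH x) // (near H x) //.
  by rewrite addrACA.
have [r0' r00' H0] := iter_log_incr R 0.
have [rs rs0 Hs] := iter_log_incr R s.
exists (Num.min r (Num.min r0' rs)); first by rewrite !lt_min r0 r00'.
near=> x => z; rewrite !le_min => /and3P[zr zr0 zrs].
rewrite /radial -expRD (near H x) // (near H0 x) // (near Hs x) //.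
by congr expR; rewrite /radial_incr; ring.
Unshelve. all: by end_near. Qed.

Lemma jet_radial_incr : jet radial_incr
  (fun x => - (d%:R + log_sum x) / 4)
  (fun x => (d%:R + log_sum x) / 8 + curv_sum x).
Proof.
have J : jet (fun x z => \sum_(1 <= k < s.+1) log_incr k x z)
   (fun x => (\sum_(1 <= j < s.+1) log_prod j x) / 2)
   (fun x => - ((\sum_(1 <= j < s.+1) log_prod j x) / 4)
     - \sum_(1 <= j < s.+1) log_curv j x).
  elim: s => [|n IH].
    exists 1, 1; split => //; near=> x; rewrite !big_geq // mul0r.
    rewrite !mul0r !oppr0 addr0 normr0; split => //.
    exists 0; rewrite ?normr0 // => z _; exists 0; rewrite ?normr0 //.
    by rewrite big_geq //; ring.
  apply: jet_eq (jetD IH (jet_log_incr R n.+1)) _; near=> x; split.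
  - by rewrite !(@big_nat_recr _ _ _ n.+1) //= mulrDl.
  - by rewrite !(@big_nat_recr _ _ _ n.+1) //=; ring.
  - by move=> z; rewrite (@big_nat_recr _ _ _ n.+1).
apply: jet_eq (jetD (jetD (jetZc (- (d%:R / 2)) (jet_log_incr R 0))
  (jetZc (- 2^-1) J)) (jetZc (- (delta / 2)) (jet_log_incr R s))) _.
near=> x; split => //; rewrite /log_sum /curv_sum log_prod0 /=; by field.
Unshelve. all: by end_near. Qed.

(* The coefficients of z and z^2 in the expansion of
   radial (x * sqrt (1 + z)) / radial x. *)
Definition drift x := - (d%:R + log_sum x) / 4.
Definition diffusion x := (d%:R + log_sum x) / 8 + curv_sum x + 2^-1 * drift x ^+ 2.

(** The origin of the bound on [V]: summed over the neighbours, [z] gives [2 d / x^2] and [z^2]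
    gives [8 / x^2] to leading order. The power [x^(-d/2)] alone yields [d (4 - d) / 4]; the cross
    terms [d * log_sum] of drift and diffusion cancel, which leaves [log_sum] with coefficient 1. *)
Lemma drift_diffusion x : 2 * d%:R * drift x + 8 * diffusion x =
  d%:R * (4 - d%:R) / 4 + log_sum x + log_sum x ^+ 2 / 4 + 8 * curv_sum x.
Proof. by rewrite /diffusion /drift; field. Qed.

(** Here [a] stands for the coordinates of a lattice point of norm [x]. Over opposite neighbours
    [z^3] adds up to [(2 + 24 a_i^2) / x^6], which is [O(x^(-4))] after summation over [i], as are
    [z^4] and the excess [2 d / x^4] of [z^2]. *)
Lemma radial_neighbour_sum : exists C : R, \forall x \near +oo,
  forall a : 'I_d -> R, \sum_i a i ^+ 2 = x ^+ 2 ->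
  \sum_i (radial (Num.sqrt (x ^+ 2 + 1 + 2 * a i))
        + radial (Num.sqrt (x ^+ 2 + 1 - 2 * a i)))
  <= radial x * (2 * d%:R + (2 * d%:R * drift x + 8 * diffusion x + C / x ^+ 2) / x ^+ 2).
Proof.
have [rr rr0 Hr] := radial_mul_sqrt.
have [M [r [r0 HM]]] := jet_comp (@taylor3_expm1 R) jet_radial_incr.
(* The three summands bound the excess of the quadratic, the cubic and the quartic terms, in units
   of [x^(-4)]. *)
exists (2 * d%:R * M + M * (2 * d%:R + 24) + M * (2 * d%:R + 80)).
near=> x => a ax.
have x1 : 1 <= x by near: x; exact: (nbhs_pinfty_ge (num_real _)).
have x0 : 0 < x by lra.
(* For [|b| <= x] and [x >= 1], [|1 + 2 b| / x^2 <= 3 / x], so both expansions apply to this [z]. *)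
have xr : 3 / Num.min r rr <= x by near: x; exact: (nbhs_pinfty_ge (num_real _)).
have [] := near HM x => // _ bM [c cM H].
have ai2 i : a i ^+ 2 <= x ^+ 2.
  by rewrite -ax (bigD1 i) //= lerDl sumr_ge0 // => j _; exact: sqr_ge0.
have aix i : `|a i| <= x.
  by rewrite -(ger0_norm (ltW x0)) -!sqrtr_sqr ler_wsqrtr.
have step b : `|b| <= x -> exists2 q : R, `|q| <= M &
    radial (Num.sqrt (x ^+ 2 + 1 + 2 * b)) = radial x * (1 +
     (drift x * ((1 + 2 * b) / x ^+ 2) + diffusion x * ((1 + 2 * b) / x ^+ 2) ^+ 2
      + c * ((1 + 2 * b) / x ^+ 2) ^+ 3 + q * ((1 + 2 * b) / x ^+ 2) ^+ 4)).
  move=> bx; set z := (1 + 2 * b) / x ^+ 2.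
  have zx : `|z| <= Num.min r rr.
    rewrite /z normrM normfV normrX (gtr0_norm x0).
    apply: (@le_trans _ _ (3 / x)); last by rewrite ler_pdivrMr // mulrC -ler_pdivrMr // lt_min r0.
    rewrite ler_pdivrMr ?exprn_gt0 // (_ : 3 / x * x ^+ 2 = 3 * x); last by field; rewrite gt_eqF.
    by apply: le_trans (ler_normD _ _) _; rewrite normr1 normrM ger0_norm; lra.
  move: zx; rewrite le_min => /andP[zr zrr].
  have [q qM e] := H z zr; exists q => //.
  have -> : Num.sqrt (x ^+ 2 + 1 + 2 * b) = x * Num.sqrt (1 + z).
    rewrite -{2}(ger0_norm (ltW x0)) -sqrtr_sqr -sqrtrM ?sqr_ge0 //.
    by congr Num.sqrt; rewrite /z; field; rewrite gt_eqF.
  by rewrite (near Hr x) // -e; congr (_ * _); ring.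
have pair i : radial (Num.sqrt (x ^+ 2 + 1 + 2 * a i))
        + radial (Num.sqrt (x ^+ 2 + 1 - 2 * a i)) <=
   radial x * (2 + drift x * (2 / x ^+ 2) + diffusion x * ((2 + 8 * a i ^+ 2) / x ^+ 4)
     + M * ((2 + 24 * a i ^+ 2) / x ^+ 6)
     + M * ((2 + 48 * a i ^+ 2 + 32 * a i ^+ 2 * x ^+ 2) / x ^+ 8)).
  have [q qM ->] := step (a i) (aix i).
  have [|q' q'M] := step (- a i) _; first by rewrite normrN.
  rewrite mulrN => ->; rewrite -mulrDr ler_wpM2l ?expR_ge0 //.
  set w := x ^- 2.
  have w0 : 0 <= w by rewrite /w invr_ge0 exprn_ge0 // ltW.
  have -> : x ^- 4 = w ^+ 2 by rewrite /w exprVn -exprM.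
  have -> : x ^- 6 = w ^+ 3 by rewrite /w exprVn -exprM.
  have -> : x ^- 8 = w ^+ 4 by rewrite /w exprVn -exprM.
  have qb (y u : R) : `|u| <= M -> u * y ^+ 4 <= M * y ^+ 4.
    move=> uM; rewrite ler_wpM2r ?exprn_even_ge0 //; exact: le_trans (ler_norm _) uM.
  have h1 := qb ((1 + 2 * a i) * w) q qM.
  have h2 := qb ((1 - 2 * a i) * w) q' q'M.
  have h3 : c * ((2 + 24 * a i ^+ 2) * w ^+ 3) <= M * ((2 + 24 * a i ^+ 2) * w ^+ 3).
    apply: ler_wpM2r; last exact: le_trans (ler_norm _) cM.
    by rewrite mulr_ge0 ?exprn_ge0 // addr_ge0 // mulr_ge0 // sqr_ge0.
  (* One factor [a i ^+ 2] is traded for [x ^+ 2], since only the sum of the squares is known. *)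
  have h4 : M * ((32 * a i ^+ 2 * a i ^+ 2) * w ^+ 4) <= M * ((32 * a i ^+ 2 * x ^+ 2) * w ^+ 4).
    apply: ler_wpM2l; first exact: le_trans cM.
    apply: ler_wpM2r; first by rewrite exprn_ge0.
    by apply: ler_wpM2l; [rewrite mulr_ge0 // sqr_ge0|].
  lra.
apply: le_trans (ler_sum _ (fun i _ => pair i)) _.
rewrite -mulr_sumr ler_wpM2l ?expR_ge0 //.
have card (u : R) : \sum_(i < d) u = d%:R * u by rewrite sumr_const card_ord mulr_natl.
have aff (u v w : R) : \sum_i (u + v * a i ^+ 2) * w = (d%:R * u + v * x ^+ 2) * w.
  by rewrite -mulr_suml big_split /= card -mulr_sumr ax.
rewrite !big_split /= -!mulr_sumr !aff !card.
have -> : \sum_i (2 + 48 * a i ^+ 2 + 32 * a i ^+ 2 * x ^+ 2) / x ^+ 8 =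
    (d%:R * 2 + (48 + 32 * x ^+ 2) * x ^+ 2) / x ^+ 8.
  by rewrite -aff; apply: eq_bigr => i _; congr (_ / _); ring.
have M0 : 0 <= M by exact: le_trans cM.
set w := x ^- 2.
have w0 : 0 <= w by rewrite /w invr_ge0 exprn_ge0 // ltW.
have w1 : w <= 1 by rewrite /w invf_le1 ?exprn_gt0 // exprn_ege1.
have xw : x ^+ 2 * w = 1 by rewrite /w divff // expf_neq0 // gt_eqF.
have -> : x ^- 4 = w ^+ 2 by rewrite /w exprVn -exprM.
have -> : x ^- 6 = w ^+ 3 by rewrite /w exprVn -exprM.
have -> : x ^- 8 = w ^+ 4 by rewrite /w exprVn -exprM.
have D0 : 0 <= d%:R :> R by [].
have e1 : (d%:R * 2 + 8 * x ^+ 2) * w ^+ 2 = 2 * d%:R * w ^+ 2 + 8 * w.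
  by rewrite /w; field; rewrite gt_eqF.
have e2 : (d%:R * 2 + 24 * x ^+ 2) * w ^+ 3 = 2 * d%:R * w ^+ 3 + 24 * w ^+ 2.
  by rewrite /w; field; rewrite gt_eqF.
have e3 : (d%:R * 2 + (48 + 32 * x ^+ 2) * x ^+ 2) * w ^+ 4 =
    2 * d%:R * w ^+ 4 + 48 * w ^+ 3 + 32 * w ^+ 2.
  by rewrite /w; field; rewrite gt_eqF.
rewrite e1 e2 e3.
have w2 : 0 <= w ^+ 2 by exact: exprn_ge0.
have w32 : w ^+ 3 <= w ^+ 2 by rewrite exprS ler_piMl.
have w42 : w ^+ 4 <= w ^+ 2.
  by apply: le_trans w32; rewrite exprS ler_piMl // exprn_ge0.
have h1 : diffusion x * (2 * d%:R * w ^+ 2) <= M * (2 * d%:R * w ^+ 2).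
  by apply: ler_wpM2r (le_trans (ler_norm _) bM); rewrite !mulr_ge0.
have h2 : d%:R * w ^+ 3 <= d%:R * w ^+ 2 by rewrite ler_wpM2l.
have h3 : d%:R * w ^+ 4 <= d%:R * w ^+ 2 by rewrite ler_wpM2l.
have h4 : M * (2 * d%:R * w ^+ 3 + 24 * w ^+ 2) <= M * ((2 * d%:R + 24) * w ^+ 2).
  by rewrite ler_wpM2l //; lra.
have h5 : M * (2 * d%:R * w ^+ 4 + 48 * w ^+ 3 + 32 * w ^+ 2) <=
    M * ((2 * d%:R + 80) * w ^+ 2).
  by rewrite ler_wpM2l //; lra.
lra.
Unshelve. all: by end_near. Qed.

End RadialSupersolution.

(** * The error terms against the margin [eps - delta] *)

Section RadialEstimate.
Variable R : realType.

(** For [s >= 1] the left side is [O(log_prod 1 x ^+ 2)], hence of smaller order than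
    [log_prod s x]. For [s = 0] there is no such gain: [log_sum] is the constant [delta], and
    [delta^2 / 4 <= delta / 4], from [delta <= 1], must fit below [eps - delta >= delta]. *)
Lemma log_sum_negligible (s : nat) (delta eps C : R) :
  0 < delta <= 1 -> delta * 2 <= eps ->
  \forall x \near +oo,
    log_sum s delta x ^+ 2 / 4 + 8 * curv_sum s delta x + C / x ^+ 2
    <= (eps - delta) * log_prod s x.
Proof.
case: s => [|s] /andP[d0 d1] de.
  near=> x.
  have x1 : 1 <= x by near: x; exact: (nbhs_pinfty_ge (num_real _)).
  have xC : C / (delta / 2) <= x by near: x; exact: (nbhs_pinfty_ge (num_real _)).
  rewrite /log_sum /curv_sum !big_geq //= log_prod0 add0r !mulr0 mulr1 addr0 mulr0 addr0 mulr1.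
  have h : C / x ^+ 2 <= delta / 2.
    rewrite ler_pdivrMr ?exprn_gt0 ?(lt_le_trans _ x1) //.
    move: xC; rewrite ler_pdivrMr ?divr_gt0 // => /le_trans; apply.
    by rewrite mulrC ler_wpM2l ?divr_ge0 ?(ltW d0) // expr2 ler_peMl // (le_trans _ x1).
  have : delta ^+ 2 <= delta by rewrite expr2 ler_piMl // ltW.
  lra.
pose n : R := s.+1%:R.
(* The summands bound [log_sum^2 / 4], [8 * curv_sum] and [C / x^2] in units of
   [log_prod 1 x ^+ 2]. *)
pose K := (n + delta) ^+ 2 / 4 + 8 * (n * n + delta / 2 * n) + `|C|.
have S1 : \forall x \near +oo, 0 <= \sum_(1 <= j < s.+2) log_prod j x <= n * log_prod 1 x.
  rewrite /n; elim: s.+1 => [|m IH]; first by near=> x; rewrite big_geq // mul0r lexx.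
  near=> x; rewrite big_nat_recr //=.
  have /andP[h1 h2] : 0 <= \sum_(1 <= j < m.+1) log_prod j x <= m%:R * log_prod 1 x by near: x.
  have h3 : log_prod m.+1 x <= log_prod 1 x by near: x; exact: log_prod_le1.
  have /andP[h4 h5] : 0 < log_prod m.+1 x <= 1 by near: x; exact: log_prod_bounds.
  by rewrite -[m.+1%:R]natr1 mulrDl mul1r; apply/andP; split; lra.
have S2 : \forall x \near +oo, \sum_(1 <= j < s.+2) log_curv j x <= n * n * log_prod 1 x ^+ 2.
  have T m : \forall x \near +oo, (m <= s.+1)%N ->
      \sum_(1 <= j < m.+1) log_curv j x <= m%:R * n * log_prod 1 x ^+ 2.
    elim: m => [|m IH]; first by near=> x => _; rewrite big_geq // !mul0r.
    near=> x => ms; rewrite big_nat_recr //=.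
    have h1 : \sum_(1 <= j < m.+1) log_curv j x <= m%:R * n * log_prod 1 x ^+ 2.
      by apply: (near IH x) => //; exact: ltnW.
    have /andP[_ h2] : 0 <= log_curv m.+1 x <= m.+1%:R * log_prod 1 x ^+ 2.
      by near: x; exact: log_curv_bounds.
    have h3 : m.+1%:R * log_prod 1 x ^+ 2 <= n * log_prod 1 x ^+ 2.
      by rewrite ler_wpM2r ?sqr_ge0 // ler_nat.
    have -> : m.+1%:R * n * log_prod 1 x ^+ 2 =
      m%:R * n * log_prod 1 x ^+ 2 + n * log_prod 1 x ^+ 2 by rewrite -natr1; ring.
    by rewrite lerD // (le_trans h2).
  by near=> x; apply: (near (T s.+1) x).
have := log_prod_sqr_negligible (K / delta) s => HK.
near=> x.
have x1 : 1 <= x by near: x; exact: (nbhs_pinfty_ge (num_real _)).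
have L1 : 1 <= iter_log 1 x by near: x; exact: iter_log_large.
have /andP[s0 s1] : 0 <= \sum_(1 <= j < s.+2) log_prod j x <= n * log_prod 1 x by near: x.
have c1 : \sum_(1 <= j < s.+2) log_curv j x <= n * n * log_prod 1 x ^+ 2 by near: x.
have /andP[_ c2] : 0 <= log_curv s.+1 x <= n * log_prod 1 x ^+ 2.
  by near: x; exact: log_curv_bounds.
have /andP[p0 p1] : 0 < log_prod s.+1 x <= 1 by near: x; exact: log_prod_bounds.
have p2 : log_prod s.+1 x <= log_prod 1 x by near: x; exact: log_prod_le1.
have k1 : K / delta * log_prod 1 x ^+ 2 <= log_prod s.+1 x by near: x.
have x2 : x ^- 2 <= log_prod 1 x ^+ 2.
  have L0 : 0 < iter_log 1 x by apply: lt_le_trans L1.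
  have x0 : 0 < x by apply: lt_le_trans x1.
  rewrite log_prodS log_prod0 mul1r exprVn lef_pV2 ?posrE ?exprn_gt0 //.
  by rewrite lerXn2r ?nnegrE ?(ltW L0) ?(ltW x0) //; apply/ltW/ln_sublinear.
have n0 : 0 <= n by rewrite /n.
set P := log_prod 1 x in x2 s1 c1 c2 p2 k1 *.
have P2 : 0 <= P ^+ 2 by exact: sqr_ge0.
have t1 : log_sum s.+1 delta x ^+ 2 <= (n + delta) ^+ 2 * P ^+ 2.
  have dp : delta * log_prod s.+1 x <= delta * P by rewrite ler_wpM2l // ltW.
  have dp0 : 0 <= delta * log_prod s.+1 x by rewrite mulr_ge0 // ltW.
  rewrite -exprMn lerXn2r // ?nnegrE /log_sum; last by rewrite mulrDl lerD.
    by rewrite addr_ge0.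
  by rewrite mulr_ge0 ?addr_ge0 ?(ltW d0) //; apply: le_trans p2; exact: ltW.
have t2 : curv_sum s.+1 delta x <= (n * n + delta / 2 * n) * P ^+ 2.
  rewrite /curv_sum mulrDl lerD //; first by have := mulr_ge0 (mulr_ge0 n0 n0) P2; lra.
  by rewrite -(mulrA (delta / 2)) ler_wpM2l // divr_ge0 // ltW.
have t3 : C / x ^+ 2 <= `|C| * P ^+ 2.
  apply: le_trans (_ : `|C| / x ^+ 2 <= _); last by rewrite ler_wpM2l.
  by rewrite ler_wpM2r ?ler_norm // invr_ge0 exprn_ge0 // (le_trans _ x1).
have t4 : K * P ^+ 2 <= delta * log_prod s.+1 x.
  by rewrite [delta * _]mulrC -ler_pdivrMr // mulrAC.
apply: (@le_trans _ _ (delta * log_prod s.+1 x)); last by rewrite ler_wpM2r ?(ltW p0) //; lra.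
apply: le_trans t4; rewrite /K; lra.
Unshelve. all: by end_near. Qed.

End RadialEstimate.

(** * Boxes and summation by parts *)

Section Box.
Variable d : nat.
Implicit Types (n m v : lattice d) (N : nat) (i : 'I_d).

(** Enumerated through a finite type of ordinal matrices, which supplies uniqueness and
    cardinality. *)
Definition box N : seq (lattice d) :=
  [seq \row_j ((A ord0 j : nat)%:Z - N%:Z) | A : 'rV['I_(2 * N).+1]_d].

Lemma mem_box N n : (n \in box N) = [forall i, `|n ord0 i| <= N%:Z].
Proof.
rewrite /box; apply/mapP/forallP => [[A _ ->] i|nN].
  by rewrite mxE; have := ltn_ord (A ord0 i); move: (A ord0 i : nat) => k; lia.
have kP i : (`|(n ord0 i + N%:Z)%R| < (2 * N).+1)%N by have := nN i; lia.
exists (\row_i Ordinal (kP i)); first by rewrite mem_enum.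
apply/rowP => i.
rewrite !mxE /=; have : `|n 0 i| <= N%:Z by exact: nN.
by move: (n 0 i) => z; lia.
Qed.

Lemma mem_boxP N n : reflect (forall i, `|n ord0 i| <= N%:Z) (n \in box N).
Proof. by rewrite mem_box; exact: forallP. Qed.

Lemma box_uniq N : uniq (box N).
Proof.
rewrite map_inj_uniq ?enum_uniq // => A B /rowP AB.
by apply/rowP => i; apply/val_inj; have := AB i; rewrite !mxE => /addIr[].
Qed.

Lemma size_box N : size (box N) = ((2 * N).+1 ^ d)%N.
Proof. by rewrite size_map -cardE card_mx card_ord mul1n. Qed.

Lemma box_sub N N' : (N <= N')%N -> {subset box N <= box N'}.
Proof.
by move=> NN' n /mem_boxP h; apply/mem_boxP => i; apply: le_trans (h i) _; lia.
Qed.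

Lemma in_some_box n : exists N, n \in box N.
Proof.
exists (\sum_i `|n ord0 i|)%N; apply/mem_boxP => i.
by rewrite (bigD1 i) //=; lia.
Qed.

Lemma seq_in_box (s : seq (lattice d)) : exists N, {subset s <= box N}.
Proof.
elim: s => [|n s [N sN]]; first by exists 0%N.
have [N' nN'] := in_some_box n; exists (maxn N N') => m.
rewrite in_cons => /predU1P[->|/sN]; first by apply: box_sub nN'; lia.
by apply: box_sub; lia.
Qed.

Definition unit_vec i : lattice d := delta_mx ord0 i.

Definition unit_step v := exists i, v = unit_vec i \/ v = - unit_vec i.

Lemma unit_step_coord v : unit_step v -> forall i, `|v ord0 i| <= 1.
Proof. by case=> i [] -> j; rewrite !mxE /=; case: (j == i). Qed.

Lemma box_step N n v : unit_step v -> n \in box N -> n + v \in box N.+1.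
Proof.
move=> /unit_step_coord v1 /mem_boxP h; apply/mem_boxP => i; rewrite mxE.
by move: (v1 i) (h i); move: (n ord0 i) (v ord0 i) => a b; lia.
Qed.

End Box.
Arguments box_uniq {d}.

Section Sums.
Variables (R : realType) (d : nat).
Implicit Types (f g u : lattice d -> R) (s t : seq (lattice d)) (N : nat) (v : lattice d).

Lemma sum_support s t f : uniq s -> uniq t ->
  (forall n, f n != 0 -> (n \in s) = (n \in t)) ->
  \sum_(n <- s) f n = \sum_(n <- t) f n.
Proof.
move=> us ut h.
have e r : \sum_(n <- r) f n = \sum_(n <- [seq n <- r | f n != 0]) f n.
  by rewrite big_filter [RHS]big_mkcond; apply: eq_bigr => n _; case: eqP.
rewrite (e s) (e t); apply: perm_big.
apply: uniq_perm; rewrite ?filter_uniq // => n.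
by rewrite !mem_filter; have [//|/h ->] := eqVneq (f n) 0.
Qed.

Lemma ler_sum_subset s t f : uniq s -> uniq t -> {subset s <= t} ->
  (forall n, 0 <= f n) -> \sum_(n <- s) f n <= \sum_(n <- t) f n.
Proof.
move=> us ut st f0; rewrite [leRHS](bigID (mem s)) /=.
have -> : \sum_(n <- s) f n = \sum_(n <- t | n \in s) f n.
  rewrite -[RHS]big_filter; apply: perm_big; apply: uniq_perm; rewrite ?filter_uniq // => n.
  by rewrite mem_filter; case ns: (n \in s) => //=; rewrite st.
by rewrite lerDl sumr_ge0.
Qed.

Lemma sum_shift s f v : uniq s ->
  (forall n, f n != 0 -> n \in s /\ n - v \in s) ->
  \sum_(n <- s) f (n + v) = \sum_(n <- s) f n.
Proof.
move=> us h; rewrite -(big_map (fun n => n + v) xpredT f); apply: sum_support => //.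
  by rewrite map_inj_uniq //; exact: addIr.
move=> n /h[ns nvs]; rewrite ns; apply/mapP; exists (n - v) => //.
by rewrite subrK.
Qed.

Definition neighbours f n := \sum_i (f (n + unit_vec i) + f (n - unit_vec i)).

(** The expression [-Delta + V] for arbitrary real functions, with no domain attached;
    [schroedinger_act] relates it to the operator. *)
Definition ham (V : lattice d -> R) f n := (2 * d%:R + V n) * f n - neighbours f n.

Definition dotp N f g := \sum_(n <- box d N) f n * g n.

Definition supported N f := forall n, n \notin box d N -> f n = 0.

Lemma supported_sub N N' f : (N <= N')%N -> supported N f -> supported N' f.
Proof. by move=> NN' h n nN; apply: h; apply: contra nN; exact: box_sub. Qed.

Lemma dotpC N f g : dotp N f g = dotp N g f.
Proof. by apply: eq_bigr => n _; rewrite mulrC. Qed.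

Lemma dotpDr N f g h : dotp N f (fun n => g n + h n) = dotp N f g + dotp N f h.
Proof. by rewrite /dotp -big_split; apply: eq_bigr => n _; rewrite mulrDr. Qed.

Lemma dotpZr N f (k : R) g : dotp N f (fun n => k * g n) = k * dotp N f g.
Proof. by rewrite /dotp mulr_sumr; apply: eq_bigr => n _; rewrite mulrCA. Qed.

Lemma dotp_ge0 N f : 0 <= dotp N f f.
Proof. by apply: sumr_ge0 => n _; rewrite -expr2 sqr_ge0. Qed.

Lemma dotp_supported N N' f g : (N <= N')%N -> supported N f ->
  dotp N' f g = dotp N f g.
Proof.
move=> NN' sf; apply: sum_support; rewrite ?box_uniq // => n.
have [nN|/sf ->] := boolP (n \in box d N); last by rewrite mul0r eqxx.
by move=> _; exact: box_sub nN.
Qed.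

Lemma dotp_norm_le N N' f : (N <= N')%N -> dotp N f f <= dotp N' f f.
Proof.
move=> NN'; apply: ler_sum_subset; rewrite ?box_uniq //; first exact: box_sub.
by move=> n; rewrite -expr2 sqr_ge0.
Qed.

Lemma dotp_neighbours N f g : dotp N f (neighbours g) =
  \sum_i (\sum_(n <- box d N) f n * g (n + unit_vec i)
        + \sum_(n <- box d N) f n * g (n - unit_vec i)).
Proof.
rewrite /dotp /neighbours; under eq_bigr do rewrite mulr_sumr.
rewrite exchange_big; apply: eq_bigr => i _; rewrite -big_split /=.
by apply: eq_bigr => n _; rewrite mulrDr.
Qed.

Lemma neighbours_sym N f g : supported N f -> supported N g ->
  dotp N f (neighbours g) = dotp N (neighbours f) g.
Proof.
move=> sf sg; rewrite [RHS]dotpC !dotp_neighbours; apply: eq_bigr => i _.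
have key v : \sum_(n <- box d N) f n * g (n + v) = \sum_(n <- box d N) g n * f (n - v).
  rewrite -(@sum_shift _ (fun n => g n * f (n - v)) v) ?box_uniq //.
    by apply: eq_bigr => n _; rewrite addrK mulrC.
  move=> n; rewrite mulf_eq0 negb_or => /andP[gn fn]; split.
    by apply: contraNT gn => /sg ->.
  by apply: contraNT fn => /sf ->.
by rewrite !key opprK addrC.
Qed.

Lemma ham_sym N V f g : supported N f -> supported N g ->
  dotp N f (ham V g) = dotp N g (ham V f).
Proof.
move=> sf sg; have e : dotp N f (neighbours g) = dotp N g (neighbours f).
  by rewrite neighbours_sym // dotpC.
transitivity (dotp N f (fun n => (2 * d%:R + V n) * g n) + -1 * dotp N f (neighbours g)).
  by rewrite -dotpZr -dotpDr; apply: eq_bigr => n _; rewrite /ham mulN1r.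
rewrite e -dotpZr /dotp -big_split; apply: eq_bigr => n _; rewrite /ham /=; ring.
Qed.

Lemma neighboursD f g n : neighbours (fun m => f m + g m) n = neighbours f n + neighbours g n.
Proof. by rewrite /neighbours -big_split; apply: eq_bigr => i _ /=; ring. Qed.

Lemma neighboursZ (k : R) f n : neighbours (fun m => k * f m) n = k * neighbours f n.
Proof. by rewrite /neighbours mulr_sumr; apply: eq_bigr => i _ /=; ring. Qed.

Lemma hamD V f g n : ham V (fun m => f m + g m) n = ham V f n + ham V g n.
Proof. by rewrite /ham neighboursD; ring. Qed.

Lemma hamZ V (k : R) f n : ham V (fun m => k * f m) n = k * ham V f n.
Proof. by rewrite /ham neighboursZ; ring. Qed.

Lemma eq_ham V f g n : f =1 g -> ham V f n = ham V g n.
Proof.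
move=> fg; rewrite /ham fg; congr (_ - _).
by apply: eq_bigr => i _; rewrite !fg.
Qed.

Definition trunc N f n := if n \in box d N then f n else 0.

Lemma supported_trunc N f : supported N (trunc N f).
Proof. by move=> n /negbTE nN; rewrite /trunc nN. Qed.

Lemma dotp_trunc N f g : dotp N (trunc N f) g = dotp N f g.
Proof. by apply: eq_big_seq => n nN; rewrite /trunc nN. Qed.

(** Only bonds leaving [box d N.+1] contribute. Such a bond joins a point outside [box d N] to one
    of [box d N.+2], and [|a b| <= (a^2 + b^2) / 2] bounds the sum, for each of the [2 d]
    directions, by half the mass of [f] in these two shells. *)
Lemma trunc_boundary N f : `|dotp N.+1 f (fun n => neighbours f n - neighbours (trunc N.+1 f) n)|
  <= d%:R * (dotp N.+2 f f - dotp N f f).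
Proof.
pose w n := f n - trunc N.+1 f n.
have -> : dotp N.+1 f (fun n => neighbours f n - neighbours (trunc N.+1 f) n) =
    dotp N.+1 f (neighbours w).
  apply: eq_bigr => n _; congr (_ * _).
  by rewrite /neighbours -sumrB; apply: eq_bigr => i _; rewrite /w; ring.
have key v : unit_step v -> `|\sum_(n <- box d N.+1) f n * w (n + v)| <=
    2^-1 * (dotp N.+2 f f - dotp N f f).
  move=> sv; apply: le_trans (ler_norm_sum _ _ _) _.
  pose F n := if n \in box d N then 0 else f n ^+ 2.
  have wE n : w n = if n \in box d N.+1 then 0 else f n.
    by rewrite /w /trunc; case: ifP; rewrite ?subrr ?subr0.
  apply: (@le_trans _ _ (2^-1 * (\sum_(n <- box d N.+1) F n
      + \sum_(n <- box d N.+1) w (n + v) ^+ 2))).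
    rewrite -big_split mulr_sumr; apply: ler_sum => n _ /=.
    rewrite /F; have [nN|nN] := boolP (n \in box d N).
      rewrite wE box_step // mulr0 normr0 expr0n /= addr0 mulr0 //.
    rewrite normrM -(real_normK (num_real (f n))) -(real_normK (num_real (w _))).
    by have := sqr_ge0 (`|f n| - `|w (n + v)|); nra.
  rewrite ler_wpM2l //.
  have -> : \sum_(n <- box d N.+1) F n = dotp N.+1 f f - dotp N f f.
    have -> : dotp N f f = dotp N.+1 (trunc N f) f.
      by rewrite (dotp_supported f (leqnSn N) (@supported_trunc N f)) dotp_trunc.
    rewrite /dotp -sumrB; apply: eq_bigr => n _.
    by rewrite /F /trunc; case: ifP => _; rewrite ?mul0r ?subrr ?subr0.
  have : \sum_(n <- box d N.+1) w (n + v) ^+ 2 <= dotp N.+2 f f - dotp N.+1 f f.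
    have -> : dotp N.+2 f f - dotp N.+1 f f = \sum_(n <- box d N.+2) w n ^+ 2.
      have -> : dotp N.+1 f f = dotp N.+2 (trunc N.+1 f) f.
        by rewrite (dotp_supported f (leqnSn _) (@supported_trunc N.+1 f)) dotp_trunc.
      rewrite /dotp -sumrB; apply: eq_bigr => n _; rewrite wE /trunc.
      by case: ifP => _; rewrite ?mul0r ?subrr ?subr0 ?expr0n.
    rewrite -(big_map (fun n => n + v) xpredT (fun n => w n ^+ 2)).
    apply: ler_sum_subset.
    - by rewrite map_inj_uniq ?box_uniq //; exact: addIr.
    - exact: box_uniq.
    - by move=> _ /mapP[n nN ->]; exact: box_step.
    - by move=> n; exact: sqr_ge0.
  by move=> h; lra.
rewrite dotp_neighbours; apply: le_trans (ler_norm_sum _ _ _) _.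
rewrite -[X in X%:R * _]card_ord mulr_natl -sumr_const; apply: ler_sum => i _.
have := key _ (ex_intro _ i (or_introl erefl)).
have := key _ (ex_intro _ i (or_intror erefl)).
set A := \sum_(n <- _) _; set B := \sum_(n <- _) _ => hA hB.
by apply: le_trans (ler_normD _ _) _; lra.
Qed.
End Sums.

(** * Quadratic forms *)

Section Forms.
Variables (R : realType) (d : nat).
Implicit Types (f g u V : lattice d -> R) (N : nat).

(** Tested on finitely supported functions only; [form_ge_bounded] extends it to square-summable
    ones, up to [eta]. *)
Definition form_ge V (e : R) := forall N f, supported N f ->
  e * dotp N f f <= dotp N f (ham V f).

(** Square-summability without infinite sums; [l2P] relates it to [l2]. *)
Definition bounded_sums u := exists M : R, forall N, dotp N u u <= M.

Lemma bounded_sums_tail u : bounded_sums u -> forall eta : R, 0 < eta ->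
  exists N0, forall N, (N0 <= N)%N -> dotp N.+2 u u - dotp N u u <= eta.
Proof.
move=> [M uM] eta eta0.
pose a N := dotp N u u.
have nd : nondecreasing_seq a by move=> m n mn; exact: dotp_norm_le.
have cv : cvgn a by apply: nondecreasing_is_cvgn => //; exists M => _ [n _ <-]; exact: uM.
have /cvgrPdist_lt /(_ _ (divr_gt0 eta0 (ltr0Sn R 1))) [N0 _ H] := cv.
exists N0 => N NN0; have := H N NN0; have := H N.+2 (leq_trans NN0 _).
rewrite /= !ltr_distlC => /(_ ltac:(lia)) /andP[h1 h2] /andP[h3 h4].
rewrite -/(a N) -/(a N.+2); lra.
Qed.

(** The diagonal terms, and with them [V], cancel in the difference; the rest is the boundary term
    of [trunc_boundary], bounded by a tail of [u]. The divisor [d.+1] instead of [d] avoids a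
    division by 0. *)
Lemma form_trunc V u : bounded_sums u -> forall eta : R, 0 < eta ->
  exists N0, forall N, (N0 <= N)%N ->
  `|dotp N (trunc N u) (ham V (trunc N u)) - dotp N u (ham V u)| <= eta.
Proof.
move=> bu eta eta0.
have e1 : 0 < eta / d.+1%:R by rewrite divr_gt0.
have [N0 H] := bounded_sums_tail bu e1; exists N0.+1 => -[//|N] /H {}H.
have -> : dotp N.+1 (trunc N.+1 u) (ham V (trunc N.+1 u)) - dotp N.+1 u (ham V u) =
    dotp N.+1 u (fun n => neighbours u n - neighbours (trunc N.+1 u) n).
  rewrite dotp_trunc -sumrB; apply: eq_big_seq => n nN.
  by rewrite /ham {1}/trunc nN; ring.
apply: le_trans (trunc_boundary _ _) _.
apply: (@le_trans _ _ (d.+1%:R * (eta / d.+1%:R))); last by rewrite mulrC divfK.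
have T0 : 0 <= dotp N.+2 u u - dotp N u u by rewrite subr_ge0 dotp_norm_le //; lia.
by rewrite ler_pM // ler_nat.
Qed.

Lemma form_ge_bounded V (e : R) u : form_ge V e -> bounded_sums u ->
  forall eta : R, 0 < eta -> exists N0, forall N, (N0 <= N)%N ->
  e * dotp N u u <= dotp N u (ham V u) + eta.
Proof.
move=> Ve bu eta /(form_trunc V bu)[N0 H]; exists N0 => N /H.
have := Ve N _ (@supported_trunc _ _ N u).
have -> : dotp N (trunc N u) (trunc N u) = dotp N u u.
  by rewrite dotp_trunc dotpC dotp_trunc.
by rewrite ler_norml => h /andP[_ h']; lra.
Qed.

(** Cauchy-Schwarz without square roots. With [c = e - lam] it converts [c |u|^2 <= <u, f>], where
    [f = (H - lam) u], into [c^2 |u|^2 <= |f|^2]. *)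
Lemma cauchy_weighted (c : R) N u f :
  2 * c * dotp N u f <= c ^+ 2 * dotp N u u + dotp N f f.
Proof.
rewrite /dotp !mulr_sumr -big_split; apply: ler_sum => n _ /=.
by have := sqr_ge0 (c * u n - f n); lra.
Qed.

Lemma resolvent_bound V (e lam : R) u : form_ge V e -> lam < e -> bounded_sums u ->
  forall eta : R, 0 < eta -> exists N0, forall N, (N0 <= N)%N ->
  (e - lam) ^+ 2 * dotp N u u <=
    dotp N (fun n => ham V u n - lam * u n) (fun n => ham V u n - lam * u n) + eta.
Proof.
move=> Ve le bu eta eta0.
have c0 : 0 < e - lam by rewrite subr_gt0.
have [|N0 H] := form_ge_bounded Ve bu (_ : 0 < eta / (2 * (e - lam))).
  by rewrite divr_gt0 // mulr_gt0.
exists N0 => N /H {}H; set f := fun n => ham V u n - lam * u n.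
have e1 : dotp N u (ham V u) = dotp N u f + lam * dotp N u u.
  rewrite -dotpZr -dotpDr; apply: eq_bigr => n _; rewrite /f; ring.
have := cauchy_weighted (e - lam) N u f.
have : 2 * (e - lam) * (e * dotp N u u) <=
    2 * (e - lam) * (dotp N u (ham V u) + eta / (2 * (e - lam))).
  by rewrite ler_wpM2l // mulr_ge0 // ltW.
rewrite [in leRHS]mulrDr [_ * (eta / _)]mulrC divfK; last by rewrite gt_eqF // mulr_gt0.
rewrite e1; lra.
Qed.

Lemma ham_sum V (K : nat) (c : 'I_K -> R) (g : 'I_K -> lattice d -> R) n :
  ham V (fun m => \sum_j c j * g j m) n = \sum_j c j * ham V (g j) n.
Proof.
elim: K c g => [|K IH] c g.
  rewrite big_ord0 /ham big_ord0 mulr0 sub0r /neighbours big1 ?oppr0 // => i _.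
  by rewrite !big_ord0 addr0.
rewrite big_ord_recl -IH -hamZ -hamD; apply: eq_ham => m.
by rewrite big_ord_recl.
Qed.

(** A square linear system. On a kernel vector the form equals [lam] times the squared norm, but it
    is at least [e] times it, so the vector is 0. *)
Lemma solve_box V (e lam : R) N f : form_ge V e -> lam < e ->
  exists2 u, supported N u & forall n, n \in box d N -> ham V u n - lam * u n = f n.
Proof.
move=> Ve le; pose K := size (box d N); pose b (i : 'I_K) := nth 0 (box d N) i.
pose dl (i : 'I_K) n : R := (n == b i)%:R.
pose emb (v : 'rV[R]_K) n := \sum_j v ord0 j * dl j n.
have embS v : supported N (emb v).
  move=> n nN; apply: big1 => j _; rewrite /dl; case: eqP => [nb|_]; last by rewrite mulr0.
  by rewrite nb mem_nth in nN.
have embb v i : emb v (b i) = v ord0 i.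
  rewrite /emb (bigD1 i) //= {1}/dl eqxx mulr1 big1 ?addr0 // => j ji.
  by rewrite /dl nth_uniq ?box_uniq // eq_sym (inj_eq val_inj) (negbTE ji) mulr0.
have boxP n : n \in box d N -> exists i, n = b i.
  by move=> nN; rewrite -index_mem in nN; exists (Ordinal nN); rewrite /b nth_index // -index_mem.
pose A : 'M[R]_K := \matrix_(j, i) (ham V (dl j) (b i) - lam * dl j (b i)).
have AE v i : (v *m A) ord0 i = ham V (emb v) (b i) - lam * emb v (b i).
  rewrite mxE ham_sum mulr_sumr -sumrB; apply: eq_bigr => j _; rewrite mxE; ring.
have Aunit : A \in unitmx.
  rewrite -row_free_unit; apply: inj_row_free => v vA.
  have Hv n : n \in box d N -> ham V (emb v) n = lam * emb v n.
    by move=> /boxP[i ->]; apply/eqP; rewrite -subr_eq0 -AE vA mxE.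
  have := Ve N _ (embS v).
  have -> : dotp N (emb v) (ham V (emb v)) = lam * dotp N (emb v) (emb v).
    by rewrite -dotpZr; apply: eq_big_seq => n /Hv ->.
  rewrite -subr_ge0 -mulrBl => h.
  have : dotp N (emb v) (emb v) <= 0.
    by rewrite -(nmulr_rge0 _ (_ : lam - e < 0)) // subr_lt0.
  move=> h0; apply/rowP => i; rewrite mxE -embb.
  have : dotp N (emb v) (emb v) == 0 by rewrite eq_le h0 dotp_ge0.
  rewrite psumr_eq0 => [/allP/(_ (b i))|n _]; last by rewrite -expr2 sqr_ge0.
  by rewrite mem_nth // mulf_eq0 orbb => /(_ isT) /eqP.
exists (emb (\row_i f (b i) *m invmx A)) => // n /boxP[i ->].
by rewrite -AE mulmxKV // mxE.
Qed.

Lemma solve_box_bound V (e lam : R) N u f : form_ge V e -> lam < e ->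
  supported N u -> (forall n, n \in box d N -> ham V u n - lam * u n = f n) ->
  (e - lam) ^+ 2 * dotp N u u <= dotp N f f.
Proof.
move=> Ve le su Hu.
have e1 : dotp N u (ham V u) = dotp N u f + lam * dotp N u u.
  rewrite -dotpZr -dotpDr; apply: eq_big_seq => n /Hu <-; ring.
have c0 : 0 < e - lam by rewrite subr_gt0.
have := cauchy_weighted (e - lam) N u f.
have : 2 * (e - lam) * (e * dotp N u u) <= 2 * (e - lam) * dotp N u (ham V u).
  by rewrite ler_wpM2l ?Ve // mulr_ge0 // ltW.
rewrite e1; lra.
Qed.

Lemma ultra_fmap (T U : Type) (h : T -> U) (G : set_system T) :
  UltraFilter G -> UltraFilter (h @ G).
Proof.
move=> GU; split; first exact: fmap_proper_filter.
move=> F FF sF; rewrite predeqE => A; split; last exact: sF.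
move=> FA; have [//|GnA] := in_ultra_setVsetC (h @^-1` A) GU.
have FnA : F (~` A) by apply: sF.
by have /filter_ex[x []] : F (A `&` ~` A) by exact: filterI.
Qed.

(** An ultrafilter finer than [\oo] replaces a diagonal subsequence: along it every eventually
    bounded real sequence converges. *)
Lemma pointwise_limit (T : Type) (u : nat -> T -> R) (B : T -> R) :
  (forall n, \forall N \near \oo, `|u N n| <= B n) ->
  exists (G : set_system nat) (psi : T -> R), [/\ ProperFilter G, \oo `<=` G &
    forall n, u N n @[N --> G] --> psi n].
Proof.
move=> uB; have [G [GU sG]] := ultraFilterLemma (_ : ProperFilter \oo).
have lim n : exists l : R, u N n @[N --> G] --> l.
  have := @segment_compact R (- B n) (B n); rewrite compact_ultra.
  move=> /(_ (u N n @[N --> G]) (ultra_fmap _ _)) [|l [_ ul]]; last by exists l.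
  apply: sG; apply: filterS (uB n) => N /=.
  by rewrite /= in_itv /= -ler_norml.
have [psi Hpsi] := choice lim.
by exists G, psi; split => //; exact: ultra_proper.
Qed.

Lemma ham_cvg (G : set_system nat) {FG : Filter G} V (u : nat -> lattice d -> R) psi :
  (forall n, u N n @[N --> G] --> psi n) ->
  forall n, ham V (u N) n @[N --> G] --> ham V psi n.
Proof.
move=> h n; apply: cvgB; first by apply: cvgMr; exact: h.
apply: cvg_big => [|i _]; first exact: add_continuous.
by apply: cvgD; exact: h.
Qed.

Lemma dotp_cvg (G : set_system nat) {FG : Filter G} (u : nat -> lattice d -> R) psi N0 :
  (forall n, u N n @[N --> G] --> psi n) ->
  dotp N0 (u N) (u N) @[N --> G] --> dotp N0 psi psi.
Proof.
move=> h; apply: cvg_big => [|n _]; first exact: add_continuous.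
by apply: cvgM; exact: h.
Qed.

Lemma sqr_le_dotp N n u : n \in box d N -> u n ^+ 2 <= dotp N u u.
Proof.
move=> nN; rewrite /dotp (big_rem n) //= -expr2 lerDl.
by apply: sumr_ge0 => m _; rewrite -expr2 sqr_ge0.
Qed.

(** The box solutions obey the bound of [solve_box_bound] uniformly in [N]. At a fixed [n] the
    equation involves finitely many values and holds for all large [N], so it passes to a pointwise
    limit; so does the bound on each box. *)
Lemma resolvent_exists V (e lam : R) f : form_ge V e -> lam < e -> bounded_sums f ->
  exists2 u, bounded_sums u & forall n, ham V u n - lam * u n = f n.
Proof.
move=> Ve le [M fM].
have c0 : 0 < (e - lam) ^+ 2 by rewrite exprn_gt0 // subr_gt0.
have /choice[u Hu] N : exists u : lattice d -> R, supported N u /\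
    forall n, n \in box d N -> ham V u n - lam * u n = f n.
  by have [u] := solve_box N f Ve le; exists u.
pose K := M / (e - lam) ^+ 2.
have uK N N0 : dotp N0 (u N) (u N) <= K.
  have [su eu] := Hu N.
  have h : dotp N (u N) (u N) <= K.
    rewrite ler_pdivlMr // mulrC; apply: le_trans (fM N).
    exact: solve_box_bound eu.
  have [NN0|NN0] := leqP N N0; first by rewrite (dotp_supported _ NN0 su).
  by apply: le_trans h; apply: dotp_norm_le; exact: ltnW.
(* [K + 1] is a bound because [t <= t^2 + 1]. *)
have [|G [psi [FG sG Hpsi]]] := @pointwise_limit _ u (fun=> K + 1).
  move=> n; near=> N.
  have [N0 nN0] := in_some_box n.
  have h : u N n ^+ 2 <= K := le_trans (sqr_le_dotp _ nN0) (uK N N0).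
  rewrite -(real_normK (num_real _)) in h.
  have := sqr_ge0 (`|u N n| - 1); have := sqr_ge0 (`|u N n|); nra.
exists psi.
  exists K => N0; apply: (cvgr_to_le (@dotp_cvg G _ u psi N0 Hpsi)).
  by apply: nearW => N; exact: uK.
move=> n; have [N0 nN0] := in_some_box n.
have cv : ham V (u N) n - lam * u N n @[N --> G] --> ham V psi n - lam * psi n.
  by apply: cvgB; [exact: ham_cvg|apply: cvgMr; exact: Hpsi].
apply: (@cvg_unique _ _ (ham V (u N) n - lam * u N n @[N --> G])) => //.
apply: cvg_near_cst; apply: sG; near=> N; apply/eqP.
have [_ ->] := Hu N => //.
by apply: box_sub nN0; near: N; exact: nbhs_infty_ge.
Unshelve. all: by end_near. Qed.

Lemma bounded_sumsD u f : bounded_sums u -> bounded_sums f ->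
  bounded_sums (fun n => u n + f n).
Proof.
move=> [M uM] [M' fM]; exists (2 * M + 2 * M') => N.
apply: le_trans (_ : 2 * dotp N u u + 2 * dotp N f f <= _); last first.
  by have := uM N; have := fM N; lra.
rewrite /dotp !mulr_sumr -big_split; apply: ler_sum => n _ /=.
by have := sqr_ge0 (u n - f n); lra.
Qed.

Lemma bounded_sumsZ (k : R) u : bounded_sums u -> bounded_sums (fun n => k * u n).
Proof.
move=> [M uM]; exists (k ^+ 2 * M) => N.
have -> : dotp N (fun n => k * u n) (fun n => k * u n) = k ^+ 2 * dotp N u u.
  by rewrite dotpZr dotpC dotpZr mulrA expr2.
by rewrite ler_wpM2l ?sqr_ge0.
Qed.

Lemma bounded_sums_le u f : bounded_sums f -> (forall n, `|u n| <= f n) -> bounded_sums u.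
Proof.
move=> [M fM] uf; exists M => N; apply: le_trans (fM N).
apply: ler_sum => n _; rewrite -!expr2 -(real_normK (num_real (u n))).
by rewrite lerXn2r ?nnegrE // (le_trans _ (uf n)).
Qed.

Lemma bounded_sums_step u v : unit_step v -> bounded_sums u ->
  bounded_sums (fun n => u (n + v)).
Proof.
move=> sv [M uM]; exists M => N; apply: le_trans (uM N.+1).
rewrite /dotp -(big_map (fun n => n + v) xpredT (fun n => u n * u n)).
apply: ler_sum_subset.
- by rewrite map_inj_uniq ?box_uniq //; exact: addIr.
- exact: box_uniq.
- by move=> _ /mapP[n nN ->]; exact: box_step.
- by move=> n; rewrite -expr2 sqr_ge0.
Qed.

Lemma bounded_sums0 : bounded_sums (fun=> 0).
Proof. by exists 0 => N; rewrite /dotp big1 // => n _; rewrite mul0r. Qed.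

Lemma bounded_sums_neighbours u : bounded_sums u -> bounded_sums (neighbours u).
Proof.
move=> bu.
suff H (s : seq 'I_d) : bounded_sums (fun n =>
    \sum_(i <- s) (u (n + unit_vec i) + u (n - unit_vec i))).
  exact: H.
elim: s => [|i s IH].
  by under eq_fun do rewrite big_nil; exact: bounded_sums0.
under eq_fun do rewrite big_cons.
apply: bounded_sumsD IH; apply: bounded_sumsD; apply: bounded_sums_step => //.
  by exists i; left.
by exists i; right.
Qed.
End Forms.

(** * Waves and the operator *)

Section LatticeGeometry.
Variables (R : realType) (d : nat).
Implicit Types (n v : lattice d).

Lemma enorm_sqr n : enorm R n ^+ 2 = \sum_i (n ord0 i)%:~R ^+ 2.
Proof. by rewrite sqr_sqrtr // sumr_ge0 // => i _; exact: sqr_ge0. Qed.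

Lemma unit_vecE (i j : 'I_d) : unit_vec i ord0 j = (j == i)%:R.
Proof. by rewrite mxE eqxx. Qed.

Lemma enorm_unit_step v : (enorm R v = 1) <-> unit_step v.
Proof.
split=> [v1|[i vi]].
  have e : \sum_i (v ord0 i) ^+ 2 = 1 :> int.
    apply: (@intr_inj R); transitivity (enorm R v ^+ 2); last by rewrite v1 expr1n.
    by rewrite enorm_sqr rmorph_sum; apply: eq_bigr => i _; rewrite rmorphXn.
  have [i vi] : exists i, v ord0 i != 0.
    apply: contrapT => /forallNP h; move: e; rewrite big1 // => i _.
    by have /negP/negPn/eqP -> := h i; rewrite expr0n.
  move: e; rewrite (bigD1 i) //=.
  have v2 : 1 <= v ord0 i ^+ 2 by rewrite -gtz0_ge1 exprn_even_gt0.
  have s0 : 0 <= \sum_(j < d | j != i) v ord0 j ^+ 2.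
    by apply: sumr_ge0 => j _; exact: sqr_ge0.
  have aux (a b : int) : 1 <= a -> 0 <= b -> a + b = 1 -> b = 0 /\ a = 1 by lia.
  move=> /(aux _ _ v2 s0)[s00 vi1].
  have vj j : j != i -> v ord0 j = 0.
    move=> ji; apply/eqP; rewrite -sqrf_eq0; move: ji.
    by apply/implyP; move/eqP: s00; rewrite psumr_eq0 => [/allP/(_ j)|k _];
      [rewrite mem_index_enum => /(_ isT)|exact: sqr_ge0].
  exists i; move/eqP: vi1; rewrite sqrf_eq1 => /orP[]/eqP vi1; [left|right].
    apply/rowP => j; rewrite unit_vecE; have [->|/vj //] := eqVneq j i; exact: vi1.
  apply/rowP => j; rewrite mxE unit_vecE; have [->|/vj ->] := eqVneq j i; first exact: vi1.
  by rewrite oppr0.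
have -> : enorm R v = Num.sqrt (\sum_j ((j == i)%:R : R)).
  congr Num.sqrt; apply: eq_bigr => j _.
  by case: vi => ->; rewrite ?mxE ?unit_vecE; case: (j == i);
    rewrite /= ?mulrNz ?sqrrN ?expr1n ?expr0n.
by rewrite (bigD1 i) //= eqxx big1 ?addr0 ?sqrtr1 // => j /negbTE ->.
Qed.

Lemma unit_vec_inj : injective (@unit_vec d).
Proof.
move=> i j /rowP/(_ i); rewrite !unit_vecE eqxx.
by case: eqP.
Qed.

Lemma neighbour_sum_fsbig (A : zmodType) (F : lattice d -> A) n :
  \sum_(m \in [set m | enorm R (m - n) = 1]) F m =
  \sum_i (F (n + unit_vec i) + F (n - unit_vec i)).
Proof.
pose s := [seq n + unit_vec i | i : 'I_d] ++ [seq n - unit_vec i | i : 'I_d].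
have us : uniq s.
  rewrite cat_uniq; apply/and3P; split.
  - by rewrite map_inj_uniq ?enum_uniq // => i j /addrI/unit_vec_inj.
  - apply/hasPn => _ /mapP[i _ ->]; apply/negP => /mapP[j _].
    move=> /addrI /rowP/(_ j); rewrite mxE !unit_vecE eqxx.
    by case: eqP.
  - by rewrite map_inj_uniq ?enum_uniq // => i j /addrI/oppr_inj/unit_vec_inj.
have -> : [set m | enorm R (m - n) = 1] = [set` s].
  apply/seteqP; split=> m /=.
    move=> /enorm_unit_step[i mi]; rewrite mem_cat; apply/orP.
    case: mi => mi; [left|right]; apply/mapP; exists i; rewrite ?mem_enum //.
      by rewrite -mi addrC subrK.
    by rewrite -mi addrC subrK.
  rewrite mem_cat => /orP[] /mapP[i _ ->]; apply/enorm_unit_step; exists i.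
    by left; rewrite addrC addKr.
  by right; rewrite addrC addKr.
rewrite -fsbig_seq // big_cat /= !big_map -!enumT big_split /=.
by rewrite !big_enum.
Qed.
End LatticeGeometry.

(** * Reduction of complex waves to pairs of real functions *)

Section ComplexWaves.
Variables (R : realType) (d : nat).
Implicit Types (psi : @wave R d) (V f g : lattice d -> R) (n : lattice d).

Definition re_part psi n := complex.Re (psi n).
Definition im_part psi n := complex.Im (psi n).
Definition mk_wave f g : @wave R d := fun n => Complex (f n) (g n).

Lemma waveE psi : psi = mk_wave (re_part psi) (im_part psi).
Proof. by apply/funext => n; rewrite /mk_wave /re_part /im_part; case: (psi n). Qed.

Lemma ReD (x y : R[i]) : complex.Re (x + y) = complex.Re x + complex.Re y.
Proof. by case: x y => [a b] [a' b']. Qed.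

Lemma ImD (x y : R[i]) : complex.Im (x + y) = complex.Im x + complex.Im y.
Proof. by case: x y => [a b] [a' b']. Qed.

Lemma complex_eq (x y : R[i]) : complex.Re x = complex.Re y ->
  complex.Im x = complex.Im y -> x = y.
Proof. by case: x y => [a b] [a' b'] /= -> ->. Qed.

Lemma schroedinger_act V f g n :
  act (schroedinger V) (mk_wave f g) n = Complex (ham V f n) (ham V g n).
Proof.
rewrite /= neighbour_sum_fsbig /potential_mul /mk_wave.
have h (u : lattice d -> R) : ham V u n =
    \sum_i ((u n - u (n + unit_vec i)) + (u n - u (n - unit_vec i))) + V n * u n.
  rewrite /ham /neighbours mulrDl.
  have -> : 2 * d%:R * u n = \sum_(i < d) (2 * u n).
    by rewrite sumr_const card_ord -mulr_natr; ring.
  rewrite addrAC; congr (_ + _); rewrite -sumrB; apply: eq_bigr => i _; ring.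
apply: complex_eq => /=.
  rewrite ReD (big_morph (@complex.Re R) ReD (erefl : complex.Re 0 = 0)) h; congr (_ + _).
  by rewrite /= mul0r subr0.
rewrite ImD (big_morph (@complex.Im R) ImD (erefl : complex.Im 0 = 0)) h; congr (_ + _).
by rewrite /= mul0r addr0.
Qed.

Lemma normc_sqr (x : R[i]) : Normc.normc x ^+ 2 = complex.Re x ^+ 2 + complex.Im x ^+ 2.
Proof. by case: x => a b /=; rewrite sqr_sqrtr // addr_ge0 // sqr_ge0. Qed.

(** Every finite set of lattice points lies in a box, so boxes exhaust the supremum that defines
    [sqsum]. *)
Lemma sqsum_le psi (M : R) :
  (forall N, dotp N (re_part psi) (re_part psi) + dotp N (im_part psi) (im_part psi) <= M) ->
  (sqsum psi <= M%:E)%E.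
Proof.
move=> h; rewrite /sqsum /esum; apply: ub_ereal_sup => _ [A [finA _] <-].
rewrite fsbig_finite //= sumEFin lee_fin.
have [N AN] := seq_in_box (finmap.enum_fset (fset_set A)); apply: le_trans (h N).
rewrite /dotp -big_split /=.
apply: le_trans (_ : \sum_(n <- box d N) Normc.normc (psi n) ^+ 2 <= _).
  apply: ler_sum_subset; rewrite ?box_uniq //; [exact: finmap.fset_uniq|].
  by move=> n; exact: sqr_ge0.
by apply: ler_sum => n _; rewrite normc_sqr /re_part /im_part !expr2.
Qed.

Lemma sqsum_ge psi N :
  ((dotp N (re_part psi) (re_part psi) + dotp N (im_part psi) (im_part psi))%:E <= sqsum psi)%E.
Proof.
apply: esum_ge; exists [set` box d N]; first by split => //; exact: finite_seq.
rewrite -fsbig_seq ?box_uniq // sumEFin lee_fin /dotp -big_split /=.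
by apply: ler_sum => n _; rewrite normc_sqr /re_part /im_part !expr2.
Qed.

Lemma l2P psi : l2 psi <-> bounded_sums (re_part psi) /\ bounded_sums (im_part psi).
Proof.
split=> [h|[[M hM] [M' hM']]].
  have e N := sqsum_ge psi N; rewrite /l2 /= in h.
  have [r er] : exists r, sqsum psi = r%:E.
    have := e 0%N; move: h; case: (sqsum psi) => [r _ _|//|//]; by exists r.
  split; exists r => N; have := e N; rewrite er lee_fin.
    by have := dotp_ge0 N (im_part psi); lra.
  by have := dotp_ge0 N (re_part psi); lra.
apply: le_lt_trans (_ : ((M + M')%:E < +oo)%E); last exact: ltry.
by apply: sqsum_le => N; rewrite lerD.
Qed.

Lemma l2norm_sqr_ge psi N : l2 psi ->
  dotp N (re_part psi) (re_part psi) + dotp N (im_part psi) (im_part psi) <= l2norm psi ^+ 2.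
Proof.
move=> h; have e := sqsum_ge psi N; rewrite /l2norm.
have s0 : (0 <= sqsum psi)%E by apply: esum_ge0 => n _; rewrite lee_fin sqr_ge0.
rewrite sqr_sqrtr ?fine_ge0 // -lee_fin fineK //.
by rewrite ge0_fin_numE.
Qed.

Lemma l2norm_le psi (K : R) : 0 <= K ->
  (forall N, dotp N (re_part psi) (re_part psi) + dotp N (im_part psi) (im_part psi) <= K ^+ 2) ->
  l2norm psi <= K.
Proof.
move=> K0 h; rewrite /l2norm -[leRHS](ger0_norm K0) -sqrtr_sqr ler_wsqrtr //.
have := sqsum_le h; have : (0 <= sqsum psi)%E by apply: esum_ge0 => n _; rewrite lee_fin sqr_ge0.
by case: (sqsum psi).
Qed.

(** The Laplacian is bounded, so [V u = ham V u + neighbours u - 2 d u] is square-summable together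
    with [u] and [ham V u], as the maximal domain demands. *)
Lemma dom_schroedinger V f g : bounded_sums f -> bounded_sums g ->
  bounded_sums (ham V f) -> bounded_sums (ham V g) -> dom (schroedinger V) (mk_wave f g).
Proof.
move=> bf bg bHf bHg.
have key (u : lattice d -> R) : bounded_sums u -> bounded_sums (ham V u) ->
    bounded_sums (fun n => V n * u n).
  move=> bu bH.
  have := bounded_sumsD bH (bounded_sumsD (bounded_sums_neighbours bu)
    (bounded_sumsZ (- (2 * d%:R)) bu)).
  by congr bounded_sums; apply/funext => n; rewrite /ham; ring.
have l : l2 (mk_wave f g) by apply/l2P.
split => //; split => //; apply/l2P.
by split; [move: (key f bf bHf)|move: (key g bg bHg)]; congr bounded_sums;
  apply/funext => n; rewrite /re_part /im_part /potential_mul /=; ring.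
Qed.

Lemma dom_schroedingerP V psi : dom (schroedinger V) psi ->
  [/\ bounded_sums (re_part psi), bounded_sums (im_part psi),
      bounded_sums (ham V (re_part psi)) & bounded_sums (ham V (im_part psi))].
Proof.
move=> [_ [/l2P[br bi] /l2P[bVr bVi]]].
have key (u : lattice d -> R) : bounded_sums u -> bounded_sums (fun n => V n * u n) ->
    bounded_sums (ham V u).
  move=> bu bV.
  have := bounded_sumsD bV (bounded_sumsD (bounded_sumsZ (2 * d%:R) bu)
    (bounded_sumsZ (-1) (bounded_sums_neighbours bu))).
  by congr bounded_sums; apply/funext => n; rewrite /ham; ring.
split => //; apply: key => //.
  by move: bVr; congr bounded_sums; apply/funext => n;
    rewrite /re_part /potential_mul; case: (psi n) => a b /=; ring.
by move: bVi; congr bounded_sums; apply/funext => n;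
  rewrite /im_part /potential_mul; case: (psi n) => a b /=; ring.
Qed.

Lemma shiftedE V (lam : R) f g n : shifted (schroedinger V) lam%:C%C (mk_wave f g) n =
  Complex (ham V f n - lam * f n) (ham V g n - lam * g n).
Proof.
rewrite /shifted schroedinger_act /mk_wave; apply: complex_eq => /=; ring.
Qed.
End ComplexWaves.

(** * Spectrum *)

Section Spectrum.
Variables (R : realType) (d : nat).
Implicit Types (V f g u : lattice d -> R) (psi : @wave R d).

Lemma shifted_re V (lam : R) psi n : re_part (shifted (schroedinger V) lam%:C%C psi) n =
  ham V (re_part psi) n - lam * re_part psi n.
Proof. by rewrite {1}[psi]waveE /re_part shiftedE. Qed.

Lemma shifted_im V (lam : R) psi n : im_part (shifted (schroedinger V) lam%:C%C psi) n =
  ham V (im_part psi) n - lam * im_part psi n.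
Proof. by rewrite {1}[psi]waveE /im_part shiftedE. Qed.

Lemma resolvent_norm V (e lam M : R) f g : form_ge V e -> lam < e ->
  bounded_sums f -> bounded_sums g ->
  (forall N, let F := fun u n => ham V u n - lam * u n in
    dotp N (F f) (F f) + dotp N (F g) (F g) <= M) ->
  forall N, (e - lam) ^+ 2 * (dotp N f f + dotp N g g) <= M.
Proof.
move=> Ve le bf bg /= h N; apply/ler_addgt0Pr => eta eta0.
have eta2 : 0 < eta / 2 by rewrite divr_gt0.
have [N1 H1] := resolvent_bound Ve le bf eta2.
have [N2 H2] := resolvent_bound Ve le bg eta2.
pose N' := maxn N (maxn N1 N2).
have := H1 N' _; have := H2 N' _; have := h N'.
set A := dotp _ _ _; set B := dotp _ _ _ => hAB.
move=> /(_ ltac:(rewrite /N'; lia)) h2 /(_ ltac:(rewrite /N'; lia)) h1.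
apply: (@le_trans _ _ ((e - lam) ^+ 2 * (dotp N' f f + dotp N' g g))); last lra.
by rewrite ler_wpM2l ?sqr_ge0 // lerD // dotp_norm_le // /N'; lia.
Qed.

Lemma resolvent_inj V (e lam : R) u : form_ge V e -> lam < e -> bounded_sums u ->
  (forall n, ham V u n - lam * u n = 0) -> forall n, u n = 0.
Proof.
move=> Ve le bu hu n; have [N nN] := in_some_box n.
have c0 : 0 < (e - lam) ^+ 2 by rewrite exprn_gt0 // subr_gt0.
have := @resolvent_norm V e lam 0 u u Ve le bu bu _ N.
have -> : dotp N u u + dotp N u u = 2 * dotp N u u by ring.
rewrite pmulr_rle0 // => H; have : 2 * dotp N u u <= 0.
  by apply: H => N' /=; rewrite /dotp big1 ?addr0 // => m _; rewrite hu mul0r.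
have := sqr_le_dotp u nN => h1 h2.
by apply/eqP; rewrite -sqrf_eq0 eq_le sqr_ge0 andbT; lra.
Qed.

Lemma form_ge_resolvent V (e lam : R) : form_ge V e -> lam < e ->
  resolvent_set (schroedinger V) lam%:C%C.
Proof.
move=> Ve le; have c0 : 0 < e - lam by rewrite subr_gt0.
have l2shift psi : dom (schroedinger V) psi -> l2 (shifted (schroedinger V) lam%:C%C psi).
  move=> /[dup] dpsi /dom_schroedingerP[b1 b2 b3 b4]; rewrite [psi]waveE.
  have -> : shifted (schroedinger V) lam%:C%C (mk_wave (re_part psi) (im_part psi)) =
      mk_wave (fun n => ham V (re_part psi) n + (- lam) * re_part psi n)
              (fun n => ham V (im_part psi) n + (- lam) * im_part psi n).
    by apply/funext => n; rewrite shiftedE /mk_wave !mulNr.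
  by apply/l2P; split; apply: bounded_sumsD => //; exact: bounded_sumsZ.
split; first split => //.
- move=> psi1 psi2; rewrite !inE => /dom_schroedingerP[b1 b2 _ _] /dom_schroedingerP[b3 b4 _ _].
  rewrite [psi1]waveE [psi2]waveE => /funeqP E.
  have key u1 u2 : bounded_sums u1 -> bounded_sums u2 ->
      (forall n, ham V u1 n - lam * u1 n = ham V u2 n - lam * u2 n) -> u1 = u2.
    move=> bu1 bu2 h; apply/funext => n; apply/eqP; rewrite -subr_eq0; apply/eqP.
    rewrite -[X in _ - X]mul1r -mulNr.
    apply: (@resolvent_inj V e lam (fun n => u1 n + -1 * u2 n)) => //.
      by apply: bounded_sumsD => //; exact: bounded_sumsZ.
    by move=> m; rewrite hamD hamZ; have := h m; lra.
  congr mk_wave; apply: key => // n; have := E n; rewrite !shiftedE; by case.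
- move=> f /l2P[bf bg].
  have [u bu Hu] := resolvent_exists Ve le bf.
  have [v bv Hv] := resolvent_exists Ve le bg.
  have bH w h : bounded_sums w -> bounded_sums h ->
      (forall n, ham V w n - lam * w n = h n) -> bounded_sums (ham V w).
    move=> bw bh Hw; have := bounded_sumsD bh (bounded_sumsZ lam bw).
    by congr bounded_sums; apply/funext => n; rewrite -Hw; ring.
  exists (mk_wave u v); first by apply: dom_schroedinger => //; [exact: bH Hu|exact: bH Hv].
  apply/funext => n; rewrite shiftedE Hu Hv [in RHS](waveE f) /mk_wave.
  by [].
- exists (e - lam)^-1 => psi dpsi; apply: l2norm_le.
    by rewrite mulr_ge0 ?sqrtr_ge0 // invr_ge0 ltW.
  have [b1 b2 _ _] := dom_schroedingerP dpsi => N.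
  rewrite exprMn exprVn mulrC ler_pdivlMr ?exprn_gt0 // mulrC.
  apply: (resolvent_norm Ve le b1 b2) => N' /=.
  apply: le_trans (l2norm_sqr_ge N' (l2shift _ dpsi)).
  by rewrite /dotp lerD // ler_sum // => n _; rewrite ?shifted_re ?shifted_im.
Qed.

Lemma ham_trunc V u N N' n : (N' < N)%N -> n \in box d N' -> ham V (trunc N u) n = ham V u n.
Proof.
move=> NN nN.
have bs v : unit_step v -> n + v \in box d N.
  by move=> sv; apply: box_sub (box_step sv nN).
rewrite /ham {1}/trunc (box_sub (ltnW NN)) //; congr (_ - _).
rewrite /neighbours; apply: eq_bigr => i _; rewrite /trunc !bs //.
  by exists i; right.
by exists i; left.
Qed.

(* If V >= e as a form and e is in the resolvent set, let chi solve
   (H - e) chi = f; the form inequality at chi - K f, where K bounds the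
   resolvent, gives <f, (H - e) f> >= |f|^2 / K. *)
Lemma form_ge_improve V (e : R) : form_ge V e ->
  resolvent_set (schroedinger V) e%:C%C -> exists2 delta : R, 0 < delta & form_ge V (e + delta).
Proof.
move=> Ve [[_ _ surj] [K0 HK0]].
(* [K0] need not be positive; enlarging it keeps the resolvent bound. *)
pose K := Num.max 1 K0; have K1 : 1 <= K by rewrite le_max lexx.
have K_gt0 : 0 < K by lra.
exists K^-1; rewrite ?invr_gt0 // => N0 f sf.
set S := dotp N0 f f.
have fS N : dotp N f f <= S.
  have [NN|NN] := leqP N0 N; first by rewrite (dotp_supported _ NN sf).
  by apply: dotp_norm_le; exact: ltnW.
have S0 : 0 <= S by exact: dotp_ge0.
have bf : bounded_sums f by exists S.
have lf : l2 (mk_wave f (fun=> 0)) by apply/l2P; split => //; exact: bounded_sums0.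
have [chi dchi Echi] := surj _ lf.
have [ba bb bHa bHb] := dom_schroedingerP dchi.
set a := re_part chi in ba bHa.
have Ha n : ham V a n = e * a n + f n.
  move/funeqP: Echi => /(_ n); rewrite {1}[chi]waveE shiftedE => -[<- _].
  by rewrite -/a; ring.
have aS N : dotp N a a <= K ^+ 2 * S.
  have h1 := l2norm_sqr_ge N dchi.1.
  have h2 : l2norm chi <= K * Num.sqrt S.
    apply: le_trans (HK0 _ dchi) _; rewrite Echi.
    apply: (@le_trans _ _ (K * l2norm (mk_wave f (fun=> 0)))).
      by rewrite ler_wpM2r ?sqrtr_ge0 // le_max lexx orbT.
    rewrite ler_wpM2l ?(ltW K_gt0) //; apply: l2norm_le; first exact: sqrtr_ge0.
    move=> N'; rewrite sqr_sqrtr // /dotp [X in _ + X]big1 ?addr0 => [|n _].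
      exact: fS.
    by rewrite mul0r.
  have h3 : l2norm chi ^+ 2 <= K ^+ 2 * S.
    rewrite -(sqr_sqrtr S0) -exprMn lerXn2r // nnegrE ?sqrtr_ge0 //.
    by rewrite mulr_ge0 ?sqrtr_ge0 // ltW.
  by have := dotp_ge0 N (im_part chi); lra.
(* Since [(H - e) a = f], the form inequality at [a - K f] reads
   [<a, f> - 2 K S + K^2 <f, (H - e) f> >= 0], while [<a, f> <= K S]. The loss [eta] pays for
   truncating [a], which need not be finitely supported. *)
have conv : forall eta : R, 0 < eta -> K * S - eta <= K ^+ 2 * (dotp N0 f (ham V f) - e * S).
  move=> eta eta0; have [N1 H1] := form_trunc V ba eta0.
  pose N := maxn N0.+1 N1.
  have NN0 : (N0 < N)%N by rewrite /N; lia.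
  have {}H1 := H1 N (ltac:(rewrite /N; lia)).
  set aN := trunc N a in H1.
  have saN : supported N aN by exact: supported_trunc.
  have sfN : supported N f by apply: supported_sub sf; exact: ltnW.
  have := Ve N (fun n => aN n + - K * f n).
  have Hl (B : lattice d -> R) : dotp N (fun n => aN n + - K * f n) B =
      dotp N aN B - K * dotp N f B.
    by rewrite dotpC dotpDr dotpZr dotpC [dotp N B f]dotpC mulNr.
  rewrite !Hl.
  have -> : dotp N aN (fun n => aN n + - K * f n) = dotp N aN aN - K * dotp N aN f.
    by rewrite dotpDr dotpZr mulNr.
  have -> : dotp N f (fun n => aN n + - K * f n) = dotp N aN f - K * S.
    by rewrite dotpDr dotpZr mulNr dotpC (dotp_supported f (ltnW NN0) sf).
  have Hlin B : dotp N B (ham V (fun n => aN n + - K * f n)) =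
      dotp N B (ham V aN) - K * dotp N B (ham V f).
    by rewrite -mulNr -dotpZr -dotpDr; apply: eq_bigr => n _; rewrite hamD hamZ.
  rewrite !Hlin (ham_sym V saN sfN).
  have -> : dotp N f (ham V f) = dotp N0 f (ham V f) by apply: dotp_supported (ltnW NN0) sf.
  have -> : dotp N f (ham V aN) = e * dotp N aN f + S.
    rewrite (dotp_supported _ (ltnW NN0) sf) [dotp N aN f]dotpC (dotp_supported _ (ltnW NN0) sf).
    rewrite -dotpZr -dotpDr; apply: eq_big_seq => n nN.
    by rewrite (ham_trunc V a NN0 nN) Ha /aN /trunc (box_sub (ltnW NN0) nN) mulrDr.
  have -> : dotp N aN aN = dotp N a a by rewrite dotp_trunc dotpC dotp_trunc.
  have -> : dotp N aN f = dotp N a f by rewrite dotp_trunc.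
  have e1 : dotp N a (ham V a) = e * dotp N a a + dotp N a f.
    by rewrite -dotpZr -dotpDr; apply: eq_bigr => n _; rewrite Ha.
  move: H1; rewrite ler_norml e1 => /andP[_ H1] Q.
  have s3 : supported N (fun n => aN n + - K * f n).
    by move=> n nN; rewrite saN // sfN // mulr0 addr0.
  have {}Q := Q s3.
  have := cauchy_weighted K^-1 N a f.
  have fSN := fS N; have aSN := aS N.
  have : K^-1 ^+ 2 * dotp N a a <= S.
    by rewrite exprVn mulrC ler_pdivrMr ?exprn_gt0 // mulrC.
  move=> c1 c2; have : dotp N a f <= K * S.
    have : 2 * (K^-1 * dotp N a f) <= 2 * S by lra.
    by rewrite ler_pM2l // mulrC ler_pdivrMr // mulrC.
  move=> c3; nra.
rewrite mulrDl -lerBrDl mulrC ler_pdivrMr //.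
suff : K * S <= K ^+ 2 * (dotp N0 f (ham V f) - e * S).
  by rewrite expr2 -mulrA ler_pM2l // mulrC.
apply/ler_addgt0Pr => eta /conv; lra.
Qed.
End Spectrum.

(** * Bottom of the spectrum, and criticality tested with point potentials *)

Section SpectralBottom.
Variables (R : realType) (d : nat).
Implicit Types (V W f g u : lattice d -> R) (psi : @wave R d).

Lemma form_ge_le V (e e' : R) : e' <= e -> form_ge V e -> form_ge V e'.
Proof.
move=> ee Ve N f /Ve; apply: le_trans.
by rewrite ler_wpM2r // dotp_ge0.
Qed.

Lemma form_ge_mono V W (e : R) : (forall n, W n <= V n) -> form_ge W e -> form_ge V e.
Proof.
move=> WV We N f /We /le_trans; apply; apply: ler_sum => n _.
have -> : f n * ham V f n = f n * ham W f n + (V n - W n) * f n ^+ 2 by rewrite /ham; ring.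
by rewrite lerDl mulr_ge0 ?sqr_ge0 // subr_ge0.
Qed.

(** This is [-Delta >= 0]: each of the [2 d] sums of [f n * f (n + v)] is at most the squared norm
    of [f]. *)
Lemma form_ge_inf V (M : R) : (forall n, M <= V n) -> form_ge V M.
Proof.
move=> MV; apply: (form_ge_mono (W := fun=> M) MV).
move=> N f sf.
have key v : unit_step v -> \sum_(n <- box d N) f n * f (n + v) <= dotp N f f.
  move=> sv; apply: (@le_trans _ _
      (2^-1 * (dotp N f f + \sum_(n <- box d N) f (n + v) * f (n + v)))).
    rewrite /dotp -big_split mulr_sumr; apply: ler_sum => n _ /=.
    by have := sqr_ge0 (f n - f (n + v)); lra.
  have : \sum_(n <- box d N) f (n + v) * f (n + v) <= dotp N f f.
    rewrite -(dotp_supported f (leqnSn N) sf) /dotp.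
    rewrite -(big_map (fun n => n + v) xpredT (fun n => f n * f n)).
    apply: ler_sum_subset.
    - by rewrite map_inj_uniq ?box_uniq //; exact: addIr.
    - exact: box_uniq.
    - by move=> _ /mapP[n nN ->]; exact: box_step.
    - by move=> n; rewrite -expr2 sqr_ge0.
  by lra.
have e1 : dotp N f (ham (fun=> M) f) = (2 * d%:R + M) * dotp N f f - dotp N f (neighbours f).
  by rewrite -dotpZr -mulN1r -dotpZr -dotpDr; apply: eq_bigr => n _; rewrite /ham mulN1r.
rewrite e1 dotp_neighbours.
have : \sum_(i < d) (\sum_(n <- box d N) f n * f (n + unit_vec i) +
    \sum_(n <- box d N) f n * f (n - unit_vec i)) <= \sum_(i < d) (2 * dotp N f f).
  apply: ler_sum => i _; have := key _ (ex_intro _ i (or_introl erefl)).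
  by have := key _ (ex_intro _ i (or_intror erefl)); lra.
rewrite sumr_const card_ord -mulr_natl; lra.
Qed.

(** From right to left: the best lower bound [sup S] of the form is attained, because the inequality
    is closed. If [sup S < e], then it lies below the spectrum, hence in the resolvent set, and
    [form_ge_improve] would raise it. The bound [M] makes [S] nonempty. *)
Theorem form_geP V (M e : R) : (forall n, M <= V n) ->
  form_ge V e <-> (e%:E <= real_inf (spectrum (schroedinger V)))%E.
Proof.
move=> MV; split=> [Ve|eV].
  apply: le_ereal_inf_tmp => _ [x xs <-]; rewrite lee_fin leNgt; apply/negP => xe.
  by apply: xs; exact: form_ge_resolvent Ve xe.
apply: contrapT => nVe; pose S := [set x | form_ge V x].
have Se : ubound S e.
  by move=> x Sx; rewrite leNgt; apply/negP => /ltW ex; apply: nVe; exact: form_ge_le Sx.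
have hS : has_sup S by split; [exists M; exact: form_ge_inf|exists e].
have supS : form_ge V (sup S).
  move=> N f sf; have [D0|D0] := eqVneq (dotp N f f) 0.
    by have := form_ge_inf MV sf; rewrite D0 !mulr0.
  have D1 : 0 < dotp N f f by rewrite lt_neqAle eq_sym D0 dotp_ge0.
  rewrite -ler_pdivlMr //; apply: ge_sup => [|x Sx]; first exact: hS.1.
  by rewrite ler_pdivlMr //; exact: Sx.
have se : sup S < e.
  rewrite lt_neqAle ge_sup ?andbT //; last exact: hS.1.
  by apply/eqP => sSe; apply: nVe; rewrite -sSe.
have [res|nres] := pselect (resolvent_set (schroedinger V) (sup S)%:C%C).
  have [delta delta0 Sd] := form_ge_improve supS res.
  by have := sup_upper_bound hS Sd; lra.
have : (real_inf (spectrum (schroedinger V)) <= (sup S)%:E)%E.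
  by apply: ereal_inf_lbound; exists (sup S).
by move=> /(le_trans eV); rewrite lee_fin leNgt se.
Qed.

Definition point_potential (t : R) : lattice d -> R := fun n => if n == 0 then t else 0.

Lemma dotp_point N f : (forall n, n != 0 -> f n = 0) -> dotp N f f = f 0 ^+ 2.
Proof.
move=> f0; have z : 0 \in box d N by apply/mem_boxP => i; rewrite mxE normr0.
rewrite /dotp (big_rem (0 : lattice d)) //= big_seq big1 ?addr0 ?expr2 // => n nN.
rewrite f0 ?mul0r //; move: nN; rewrite rem_filter ?box_uniq // mem_filter.
by case/andP.
Qed.

Lemma point_potential_re (t : R) psi n :
  re_part (potential_mul (point_potential t) psi) n = point_potential t n * re_part psi n.
Proof. by rewrite /re_part /potential_mul; case: (psi n) => a b /=; ring. Qed.

Lemma point_potential_im (t : R) psi n :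
  im_part (potential_mul (point_potential t) psi) n = point_potential t n * im_part psi n.
Proof. by rewrite /im_part /potential_mul; case: (psi n) => a b /=; ring. Qed.

Lemma point_potential_l2 (t : R) psi : l2 (potential_mul (point_potential t) psi).
Proof.
have key f : (forall n, n != 0 -> f n = 0) -> bounded_sums f.
  by move=> f0; exists (f 0 ^+ 2) => N; rewrite dotp_point.
apply/l2P; split; apply: key => n /negbTE n0.
  by rewrite point_potential_re /point_potential n0 mul0r.
by rewrite point_potential_im /point_potential n0 mul0r.
Qed.

Lemma l2D psi psi' : l2 psi -> l2 psi' -> l2 (fun n => psi n + psi' n).
Proof.
move=> /l2P[h1 h2] /l2P[h3 h4]; apply/l2P; split.
  by have := bounded_sumsD h1 h3; congr bounded_sums; apply/funext => n; rewrite /re_part ReD.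
by have := bounded_sumsD h2 h4; congr bounded_sums; apply/funext => n; rewrite /im_part ImD.
Qed.

(** The equality includes the domains, because a point potential maps every wave into [l2]. *)
Lemma sub_point_potential V (t : R) :
  op_sub (schroedinger V) (potential_op (point_potential t)) =
  schroedinger (fun n => V n + point_potential (- t) n).
Proof.
have E psi n : potential_mul (fun m => V m + point_potential (- t) m) psi n =
    potential_mul V psi n + potential_mul (point_potential (- t)) psi n.
  by rewrite /potential_mul rmorphD mulrDl.
have N psi n : potential_mul (point_potential (- t)) psi n =
    - potential_mul (point_potential t) psi n.
  by rewrite /potential_mul /point_potential; case: ifP => _;
    rewrite ?rmorphN ?rmorph0 ?mulNr ?mul0r ?oppr0.
congr Operator.
  apply/seteqP; split=> psi /=.
    move=> [[h1 [_ h2]] _]; split=> //; split => //.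
    by rewrite (funext (E psi)); apply: l2D => //; exact: point_potential_l2.
  move=> [h1 [_ h2]]; split; last by split => //; exact: point_potential_l2.
  split => //; split => //.
  have := l2D h2 (point_potential_l2 t psi); congr l2; apply/funext => n.
  by rewrite E N subrK.
by apply/funext => psi; apply/funext => n /=; rewrite E N addrA.
Qed.

Lemma re_im_bound psi n (M : R) : l2 psi -> l2norm psi <= M ->
  `|re_part psi n| <= M /\ `|im_part psi n| <= M.
Proof.
move=> h1 h2; have [N nN] := in_some_box n.
have M0 : 0 <= M by apply: le_trans h2; exact: sqrtr_ge0.
have h3 := l2norm_sqr_ge N h1.
have h4 : l2norm psi ^+ 2 <= M ^+ 2 by rewrite lerXn2r // nnegrE ?sqrtr_ge0.
have h5 := sqr_le_dotp (re_part psi) nN; have h6 := sqr_le_dotp (im_part psi) nN.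
have h7 := dotp_ge0 N (re_part psi); have h8 := dotp_ge0 N (im_part psi).
by split; rewrite -(ger0_norm M0) -!sqrtr_sqr ler_wsqrtr //; lra.
Qed.

Lemma bounded_subsequence (a : nat -> R) (M : R) : (forall k, `|a k| <= M) ->
  exists (phi : nat -> nat) (l : R), {homo phi : i j / (i < j)%N} /\ a (phi k) @[k --> \oo] --> l.
Proof.
move=> aM; have [|phi inc cv] := @bolzano_weierstrass R a.
  exists M; split; first exact: num_real.
  by move=> x Mx n _; apply: le_trans (aM n) _; exact: ltW.
exists phi, (lim (a \o phi @ \oo)); split => //.
move=> i j; rewrite ltnNge [in X in _ -> X]ltnNge; apply: contra => h.
by move: (inc j i) => <-.
Qed.

(** Only the value at 0 of a wave matters; two successive Bolzano-Weierstrass extractions make its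
    real and imaginary parts converge. *)
Lemma compact_point_potential (t : R) : compact_operator (potential_op (point_potential t)).
Proof.
split.
  by apply/seteqP; split=> psi /=; [case|split => //; exact: point_potential_l2].
move=> u lu [M uM].
have rb k := (re_im_bound 0 (lu k) (uM k)).1.
have ib k := (re_im_bound 0 (lu k) (uM k)).2.
have [p1 [l1 [inc1 cv1]]] := bounded_subsequence rb.
have [p2 [l2' [inc2 cv2]]] := bounded_subsequence (fun k => ib (p1 k)).
have cv1' : re_part (u (p1 (p2 k))) 0 @[k --> \oo] --> l1.
  apply: (cvg_comp p2 (fun k => re_part (u (p1 k)) 0)) cv1.
  apply/cvgnyPge => N; near=> k.
  apply: (@leq_trans k); first by near: k; exact: nbhs_infty_ge.
  elim: (k) => // j IH; exact: leq_ltn_trans IH (inc2 _ _ (ltnSn j)).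
(* The constant function serves as argument although it need not be in [l2]: the point potential
   sees only its value at 0. *)
exists (p1 \o p2), (potential_mul (point_potential t) (fun=> Complex l1 l2')); split.
- by move=> i j ij; apply: inc1; exact: inc2.
- exact: point_potential_l2.
pose D k := `|t| * (`|re_part (u (p1 (p2 k))) 0 - l1| + `|im_part (u (p1 (p2 k))) 0 - l2'|).
apply: (@squeeze_cvgr _ _ _ _ (fun=> 0) D); last 2 first.
- exact: cvg_cst.
- have cv0 (x : nat -> R) l : x k @[k --> \oo] --> l -> `|x k - l| @[k --> \oo] --> (0 : R).
    move=> xl; have : `|x k - l| @[k --> \oo] --> `|l - l|.
      by apply: cvg_norm; apply: cvgB => //; exact: cvg_cst.
    by rewrite subrr normr0.
  have : D k @[k --> \oo] --> `|t| * (0 + 0) by apply: cvgMr; apply: cvgD; exact: cv0.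
  by rewrite addr0 mulr0.
near=> k; rewrite sqrtr_ge0 /=; apply: l2norm_le.
  by rewrite mulr_ge0 ?addr_ge0.
move=> N; set w := fun n => _.
have wr n : re_part w n = point_potential t n * (re_part (u (p1 (p2 k))) n - l1).
  by rewrite /w /re_part /potential_mul /=; case: (u _ n) => a b /=; ring.
have wi n : im_part w n = point_potential t n * (im_part (u (p1 (p2 k))) n - l2').
  by rewrite /w /im_part /potential_mul /=; case: (u _ n) => a b /=; ring.
rewrite !dotp_point; last 2 first.
- by move=> n /negbTE n0; rewrite wi /point_potential n0 mul0r.
- by move=> n /negbTE n0; rewrite wr /point_potential n0 mul0r.
rewrite wr wi /point_potential eqxx /D !exprMn.
rewrite -(real_normK (num_real t)) -mulrDr ler_wpM2l ?sqr_ge0 //.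
set x := re_part _ _ - _; set y := im_part _ _ - _.
rewrite -(real_normK (num_real x)) -(real_normK (num_real y)) sqrrD.
by have : 0 <= `|x| * `|y|; [rewrite mulr_ge0|lra].
Unshelve. all: by end_near. Qed.

(** If [H_V - t delta_0] still had a nonnegative form, then its spectrum would have infimum 0 like
    that of [H_V], and criticality would give [t = 0]. *)
Theorem critical_form V (M : R) : (forall n, M <= V n) ->
  critical_at V 0 ->
  form_ge V 0 /\ forall t, 0 < t -> ~ form_ge (fun n => V n + point_potential (- t) n) 0.
Proof.
move=> MV [inf0 crit].
have V0 : form_ge V 0 by apply/(form_geP 0 MV); rewrite inf0.
split => // t t0 Vt.
have MV' n : M - t <= V n + point_potential (- t) n.
  by rewrite /point_potential; case: ifP => _; have := MV n; lra.
have : point_potential t 0 = 0.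
  apply: (crit (point_potential t)).
  - exact: compact_point_potential.
  - by move=> n; rewrite /point_potential; case: ifP => // _; exact: ltW.
  rewrite sub_point_potential; apply/eqP; rewrite eq_le; apply/andP; split; last first.
    exact/(form_geP _ MV').
  rewrite leNgt; apply/negP => lt0.
  (* The infimum might a priori be [+oo], so some positive real below it is taken. By monotonicity
     it would also be a lower bound for [H_V], against [inf0]. *)
  have [e e0 eV] : exists2 e : R, 0 < e &
      (e%:E <= real_inf (spectrum (schroedinger (fun n => (V n + point_potential (- t) n)%R))))%E.
    move: lt0; case: (real_inf _) => [r|_|//]; last by exists 1; rewrite ?leey.
    by rewrite lte_fin => r0; exists r.
  have /(form_geP e MV) : form_ge V e.
    move/(form_geP _ MV'): eV; apply: form_ge_mono => n.
    by rewrite /point_potential; case: ifP => _; lra.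
  by rewrite inf0 lee_fin leNgt e0.
by rewrite /point_potential eqxx; lra.
Qed.
End SpectralBottom.

(** * The ground state *)

Section GroundState.
Variables (R : realType) (d : nat).
Implicit Types (V f g u phi : lattice d -> R).

Definition dirac0 (n : lattice d) : R := (n == 0)%:R.

Lemma mem0_box N : 0 \in box d N.
Proof. by apply/mem_boxP => i; rewrite mxE normr0. Qed.

Lemma dotp_dirac0 N f : dotp N f dirac0 = f 0.
Proof.
rewrite /dotp (big_rem (0 : lattice d)) ?mem0_box //= /dirac0 eqxx mulr1.
rewrite big_seq big1 ?addr0 // => n; rewrite rem_filter ?box_uniq // mem_filter.
by case/andP => /negbTE /= ->; rewrite mulr0.
Qed.

(** The equation is tested with the negative part [m] of [g = p - m]. Since [m p = 0] and the
    off-diagonal entries of [H] are nonpositive, [<m, H p> <= 0]; hence [lam |m|^2 >= 0], so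
    [m = 0]. *)
Lemma solution_ge0 V (lam : R) N g h : form_ge V 0 -> lam < 0 -> supported N g ->
  (forall n, 0 <= h n) ->
  (forall n, n \in box d N -> ham V g n - lam * g n = h n) -> forall n, 0 <= g n.
Proof.
move=> V0 l0 sg h0 Hg.
pose p n := Num.max (g n) 0; pose m n := Num.max (- g n) 0.
have p0 n : 0 <= p n by rewrite le_max lexx orbT.
have m0 n : 0 <= m n by rewrite le_max lexx orbT.
have gE n : g n = p n + -1 * m n.
  by rewrite /p /m; case: (leP (g n) 0) => gn; case: (leP (- g n) 0) => gn'; lra.
have pm n : m n * p n = 0.
  rewrite /p /m; case: (leP (g n) 0) => gn; first by rewrite mulr0.
  by case: (leP (- g n) 0) => gn'; [rewrite mul0r|lra].
have sm : supported N m by move=> n nN; rewrite /m sg // oppr0 maxxx.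
have e1 : dotp N m h = dotp N m (ham V p) - dotp N m (ham V m) + lam * dotp N m m.
  rewrite -[- dotp _ _ _]mulN1r -!dotpZr -!dotpDr; apply: eq_big_seq => n nN.
  rewrite -Hg // (eq_ham V n gE) hamD hamZ gE; have := pm n.
  move: (p n) (m n) (ham V p n) (ham V m n) => a b A B ab.
  by transitivity (b * (A + -1 * B + lam * b) - lam * (b * a)); [|rewrite ab]; ring.
have e2 : dotp N m (ham V p) <= 0.
  rewrite -oppr_ge0 -sumrN; apply: sumr_ge0 => n _; rewrite /ham.
  have -> : - (m n * ((2 * d%:R + V n) * p n - neighbours p n)) =
    m n * neighbours p n - (2 * d%:R + V n) * (m n * p n) by ring.
  rewrite pm mulr0 subr0 mulr_ge0 //; apply: sumr_ge0 => i _; exact: addr_ge0.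
have e3 : 0 <= dotp N m (ham V m) by have := V0 N m sm; rewrite mul0r.
have e4 : 0 <= dotp N m h by apply: sumr_ge0 => n _; exact: mulr_ge0.
have e5 : dotp N m m <= 0.
  by rewrite -(nmulr_rge0 _ l0); lra.
move=> n; have [nN|nN] := boolP (n \in box d N); last by rewrite sg.
have : m n ^+ 2 <= 0 by apply: le_trans e5; exact: sqr_le_dotp.
rewrite le_eqVlt ltNge sqr_ge0 orbF sqrf_eq0 => /eqP mn.
by rewrite gE mn mulr0 addr0.
Qed.

(* The positive mass 1 / (N + 1), as a negative spectral value, makes the box
   problems uniquely solvable and the comparison principle strict. *)
Definition mass N : R := - (N.+1%:R)^-1.

Definition green V (g : nat -> lattice d -> R) := forall N,
  [/\ supported N (g N), forall n, 0 <= g N n &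
      forall n, n \in box d N -> ham V (g N) n - mass N * g N n = dirac0 n].

Lemma mass_lt0 N : mass N < 0.
Proof. by rewrite oppr_lt0 invr_gt0. Qed.

Lemma green_exists V : form_ge V 0 -> exists g : nat -> lattice d -> R, green V g.
Proof.
move=> V0; suff /choice[g Hg] N : exists g, [/\ supported N g, forall n, 0 <= g n &
    forall n, n \in box d N -> ham V g n - mass N * g n = dirac0 n] by exists g.
have [g sg Hg] := solve_box N dirac0 V0 (mass_lt0 N); exists g; split => //.
by apply: solution_ge0 (mass_lt0 N) sg _ Hg => // n; rewrite /dirac0; case: eqP.
Qed.

Lemma inv_succ_small (eta : R) : 0 < eta -> \forall N \near \oo, (N.+1%:R)^-1 <= eta.
Proof.
move=> eta0; near=> N.
rewrite -[eta]invrK lef_pV2 ?posrE ?invr_gt0 //.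
apply: le_trans (_ : N%:R <= _); last by rewrite ler_nat.
by near: N; exact: nbhs_infty_ger.
Unshelve. all: by end_near. Qed.

(** Behind this is the variational principle that [1 / g N 0] is the minimum of
    [<f, (H - mass N) f> / f(0)^2] over [f] on the box. Failure of positivity for [t = 1 / A]
    supplies an [f] with [<f, H f> < f(0)^2 / A], and a small mass preserves the strict
    inequality. *)
Lemma green_large V (g : nat -> lattice d -> R) : form_ge V 0 -> green V g ->
  (forall t, 0 < t -> ~ form_ge (fun n => V n + point_potential (- t) n) 0) ->
  forall A : R, 0 < A -> \forall N \near \oo, A <= g N 0.
Proof.
move=> V0 Hg crit A A0.
have /crit : 0 < A^-1 by rewrite invr_gt0.
move=> /existsNP[N1 /existsNP[f /not_implyP[sf /negP]]].
rewrite mul0r -ltNge => Qf.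
have {}Qf : dotp N1 f (ham V f) < f 0 ^+ 2 / A.
  suff e : dotp N1 f (ham (fun n => V n + point_potential (- A^-1) n) f) =
      dotp N1 f (ham V f) - f 0 ^+ 2 / A by move: Qf; rewrite e; lra.
  have -> : f 0 ^+ 2 / A = dotp N1 (fun n => f n ^+ 2 / A) dirac0 by rewrite dotp_dirac0.
  rewrite -[- dotp _ _ _]mulN1r -dotpZr.
  rewrite /dotp -big_split; apply: eq_bigr => n _ /=.
  by rewrite /ham /point_potential /dirac0; case: eqP => _; rewrite /=; ring.
set S := dotp N1 f f; set Q := dotp N1 f (ham V f) in Qf.
have S0 : 0 <= S := dotp_ge0 N1 f.
(* Chosen so that [eta * S] is less than the gap [f 0 ^+ 2 / A - Q], even if [S = 0]. *)
pose eta := (f 0 ^+ 2 / A - Q) / (S + 1).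
have eta0 : 0 < eta by rewrite divr_gt0 ?subr_gt0 //; lra.
have small := inv_succ_small eta0.
near=> N; rewrite leNgt; apply/negP => gA.
have [sg g0 Eg] := Hg N.
have N1N : (N1 <= N)%N by near: N; exact: nbhs_infty_ge.
have sfN := supported_sub N1N sf.
(* The optimal coefficient of [g N] would be [f 0 / g N 0]; under the assumption [g N 0 < A], [A] in
   its place is good enough. *)
pose s := f 0 / A.
pose w n := f n + - s * g N n.
have sw : supported N w by move=> n nN; rewrite /w sfN // sg // mulr0 addr0.
have := V0 N w sw; rewrite mul0r.
have e1 h : dotp N w h = dotp N f h - s * dotp N (g N) h.
  by rewrite dotpC dotpDr dotpZr dotpC [dotp N h (g N)]dotpC mulNr.
have e2 h : dotp N h (ham V w) = dotp N h (ham V f) - s * dotp N h (ham V (g N)).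
  by rewrite -mulNr -dotpZr -dotpDr; apply: eq_bigr => n _; rewrite hamD hamZ.
have e3 h : dotp N h (ham V (g N)) = h 0 + mass N * dotp N h (g N).
  rewrite -(dotp_dirac0 N h) -dotpZr -dotpDr; apply: eq_big_seq => n nN.
  by rewrite -Eg // subrK.
rewrite !e1 !e2 (ham_sym V sg sfN) !e3 !(dotp_supported _ N1N sf) -/Q.
have m0 := mass_lt0 N.
have ww := dotp_ge0 N w.
have : mass N * dotp N w w <= 0 by rewrite nmulr_rle0.
have -> : dotp N w w = S - 2 * s * dotp N1 f (g N) + s ^+ 2 * dotp N (g N) (g N).
  rewrite e1 /w !dotpDr !dotpZr [dotp N (g N) f]dotpC !(dotp_supported _ N1N sf) -/S; ring.
have fA : s * A = f 0 by rewrite /s divfK // gt_eqF.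
have sg2 : s ^+ 2 * g N 0 <= s ^+ 2 * A by rewrite ler_wpM2l ?sqr_ge0 // ltW.
have sA : s ^+ 2 * A = s * f 0 by rewrite -fA; ring.
have QA : f 0 ^+ 2 / A = s * f 0 by rewrite /s; ring.
have mS : - mass N * S < s * f 0 - Q.
  have mm : - mass N <= eta by rewrite /mass opprK; near: N.
  apply: (@le_lt_trans _ _ (eta * S)); first by rewrite ler_wpM2r.
  rewrite -QA; have -> : f 0 ^+ 2 / A - Q = eta * (S + 1) by rewrite /eta divfK // gt_eqF //; lra.
  by rewrite ltr_pM2l // ltrDl.
move: sg2 sA mS; rewrite -fA.
lra.
Unshelve. all: by end_near. Qed.

Lemma seq_argmax (T : eqType) (s : seq T) (rho : T -> R) x0 : x0 \in s ->
  exists2 x, x \in s & forall y, y \in s -> rho y <= rho x.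
Proof.
elim: s x0 => // x s IH x0 _; case: s IH => [_|y s IH].
  by exists x; rewrite ?mem_head // => z; rewrite inE => /eqP ->.
have [z zs zmax] := IH y (mem_head _ _).
have [xz|xz] := leP (rho x) (rho z).
  by exists z => [|w]; rewrite in_cons ?zs ?orbT // => /predU1P[->|/zmax].
exists x => [|w]; first exact: mem_head.
by rewrite in_cons => /predU1P[->//|/zmax h]; apply: le_trans h (ltW xz).
Qed.

(** If [u / phi] exceeded [C], its maximum [rho] over the box would be attained at some [x] outside
    [box d r]. There [rho * phi] touches [u] from above, so [ham V u x >= rho * ham V phi x >= 0],
    against [ham V u x <= lam * u x < 0]. *)
Lemma comparison V phi u (C lam : R) N r : lam < 0 -> 0 <= C -> (forall n, 0 < phi n) ->
  (forall n, n \notin box d r -> 0 <= ham V phi n) ->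
  supported N u ->
  (forall n, n \in box d N -> n \notin box d r -> ham V u n <= lam * u n) ->
  (forall n, n \in box d r -> u n <= C * phi n) ->
  forall n, u n <= C * phi n.
Proof.
move=> l0 C0 phi0 Hphi su Hu ur.
have [x xN xmax] := seq_argmax (fun n => u n / phi n) (mem0_box N).
have uM m : u m <= Num.max (u x / phi x) 0 * phi m.
  have [mN|mN] := boolP (m \in box d N).
    rewrite -ler_pdivrMr //; apply: le_trans (xmax m mN) _.
    by rewrite le_max lexx.
  by rewrite su // mulr_ge0 ?(ltW (phi0 _)) // le_max lexx orbT.
have [xC|xC] := leP (u x / phi x) C.
  move=> n; apply: le_trans (uM n) _; rewrite ler_wpM2r ?(ltW (phi0 n)) //.
  by rewrite ge_max xC.
have x0 : 0 < u x / phi x by exact: le_lt_trans xC.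
have xr : x \notin box d r.
  by apply/negP => /ur; rewrite -ler_pdivrMr // leNgt xC.
move: uM; rewrite (max_l (ltW x0)); set rho := u x / phi x => uM.
have ux : u x = rho * phi x by rewrite /rho divfK // gt_eqF.
have := Hu x xN xr; rewrite leNgt => /negP[].
apply: (@lt_le_trans _ _ 0); first by rewrite nmulr_rlt0 // ux mulr_gt0.
apply: le_trans (_ : rho * ham V phi x <= _); first by rewrite mulr_ge0 ?Hphi // ltW.
rewrite /ham {1}ux mulrBr mulrCA lerD2l lerN2 /neighbours mulr_sumr.
by apply: ler_sum => i _; rewrite mulrDr lerD.
Qed.

(** Normalizing by the sum [c N] over a fixed finite box both bounds [u N] there and keeps the limit
    nonzero. As [c N >= g N 0] tends to infinity, the source [(c N)^-1 * dirac0] disappears in the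
    limit, along with the mass term. *)
Theorem ground_state V phi r : (forall n, 0 < phi n) -> bounded_sums phi ->
  (forall n, n \notin box d r -> 0 <= ham V phi n) ->
  form_ge V 0 ->
  (forall t, 0 < t -> ~ form_ge (fun n => V n + point_potential (- t) n) 0) ->
  exists psi : lattice d -> R,
    [/\ bounded_sums psi, exists n, psi n != 0 & forall n, ham V psi n = 0].
Proof.
move=> phi0 bphi Hphi V0 crit.
have [g Hg] := green_exists V0.
have large := green_large V0 Hg crit.
pose c N := \sum_(n <- box d r) g N n.
have cg N : g N 0 <= c N.
  have [_ g0 _] := Hg N.
  by rewrite /c (big_rem (0 : lattice d)) ?mem0_box //= lerDl sumr_ge0.
have c_gt0 : \forall N \near \oo, 0 < c N.
  near=> N; apply: lt_le_trans (cg N); apply: (@lt_le_trans _ _ 1) => //.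
  by near: N; exact: large.
pose u N n := (c N)^-1 * g N n.
(* This [C] gives [C * phi >= 1] on [box d r], where the normalized nonnegative [u N] is at most
   1. *)
pose C := \sum_(n <- box d r) (phi n)^-1.
have C0 : 0 <= C by apply: sumr_ge0 => n _; rewrite invr_ge0 ltW.
have Cphi n : n \in box d r -> 1 <= C * phi n.
  move=> nr; rewrite -ler_pdivrMr // mul1r /C (big_rem n) //= lerDl.
  by apply: sumr_ge0 => m _; rewrite invr_ge0 ltW.
have u_eq : \forall N \near \oo, forall n, n \in box d N ->
    ham V (u N) n = mass N * u N n + (c N)^-1 * dirac0 n.
  near=> N => n nN; have [_ _ Eg] := Hg N.
  by rewrite hamZ -Eg // /u; ring.
have u_bound : \forall N \near \oo, forall n, 0 <= u N n <= C * phi n.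
  near=> N; have [sg g0 Eg] := Hg N.
  have cN : 0 < c N by near: N.
  have u0 n : 0 <= u N n by rewrite mulr_ge0 // invr_ge0 ltW.
  move=> n; rewrite u0 /=; move: n.
  apply: (@comparison V phi (u N) C (mass N) N r) => //.
  - exact: mass_lt0.
  - by move=> n nN; rewrite /u sg // mulr0.
  - move=> n nN nr; rewrite hamZ /u mulrCA ler_pM2l ?invr_gt0 //.
    (* Outside [box d r] the source vanishes, since 0 lies in every box. *)
    have := Eg n nN; rewrite /dirac0; case: eqP nr => [->|_ _]; first by rewrite mem0_box.
    by move=> /eqP; rewrite subr_eq0 => /eqP ->.
  - move=> n nr; apply: le_trans (Cphi n nr).
    rewrite /u mulrC ler_pdivrMr // mul1r /c (big_rem n) //= lerDl.
    exact: sumr_ge0.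
have u_le n : \forall N \near \oo, `|u N n| <= C * phi n.
  near=> N; have /(_ n)/andP[h0 h1] : forall n, 0 <= u N n <= C * phi n by near: N.
  by rewrite ger0_norm.
have [G [psi [FG sG Hpsi]]] := pointwise_limit u_le.
exists psi; split.
- apply: (bounded_sums_le (bounded_sumsZ C bphi)) => n.
  apply: (cvgr_to_le (cvg_norm (Hpsi n))); apply: sG; exact: u_le.
- have s1 : \sum_(n <- box d r) psi n = 1.
    have cv : \sum_(n <- box d r) u N n @[N --> G] --> \sum_(n <- box d r) psi n.
      by apply: cvg_big => [|n _]; [exact: add_continuous|exact: Hpsi].
    apply: (@cvg_unique _ _ (\sum_(n <- box d r) u N n @[N --> G])) => //.
    apply: cvg_near_cst; apply: sG; near=> N; apply/eqP.
    rewrite /u -mulr_sumr mulVf // gt_eqF //.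
    by near: N.
  apply: contrapT => /forallNP h; move: s1; rewrite big1 => [/esym/eqP|n _].
    by rewrite oner_eq0.
  by have /negP/negPn/eqP := h n.
- move=> n; apply/eqP; rewrite -normr_le0; apply/ler_addgt0Pr => eta eta0; rewrite add0r.
  have cv : `|ham V (u N) n| @[N --> G] --> `|ham V psi n|.
    by apply: cvg_norm; exact: ham_cvg.
  apply: (cvgr_to_le cv); apply: sG.
  have [N0 nN0] := in_some_box n.
  have eta1 : 0 < eta / (2 * (C * phi n + 1)).
    by rewrite divr_gt0 // mulr_gt0 // ltr_wpDl // mulr_ge0 // ltW.
  have small := inv_succ_small eta1.
  near=> N.
  have cN : 0 < c N by near: N.
  have -> : ham V (u N) n = mass N * u N n + (c N)^-1 * dirac0 n.
    apply: (near u_eq N) => //; apply: box_sub nN0.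
    by near: N; exact: nbhs_infty_ge.
  have /(_ n)/andP[h0 h1] : forall n, 0 <= u N n <= C * phi n by near: N.
  have c1 : (c N)^-1 <= eta / 2.
    rewrite -[leRHS]invrK lef_pV2 ?posrE ?invr_gt0 ?divr_gt0 //.
    apply: le_trans (cg N); near: N; apply: large.
    by rewrite invr_gt0 divr_gt0.
  have d1 : 0 <= (dirac0 n : R) <= 1 by rewrite /dirac0; case: eqP; rewrite ?lexx ler01.
  apply: le_trans (ler_normD _ _) _; rewrite [eta]splitr; apply: lerD.
    rewrite normrM /mass normrN (ger0_norm h0) ger0_norm ?invr_ge0 //.
    apply: (@le_trans _ _ (eta / (2 * (C * phi n + 1)) * (C * phi n + 1))); last first.
      by rewrite invfM mulrA divfK // gt_eqF // ltr_wpDl // mulr_ge0 // ltW.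
    rewrite ler_pM ?invr_ge0 //; first by near: N.
    by apply: le_trans h1 _; rewrite lerDl.
  have /andP[d0 d2] := d1.
  rewrite ger0_norm ?mulr_ge0 // ?invr_ge0 ?(ltW cN) //.
  by apply: le_trans c1; rewrite ler_piMr // invr_ge0 ltW.
Unshelve. all: by end_near. Qed.
End GroundState.

(** * Summability of the radial supersolution *)

Section RadialSummability.
Variable R : realType.

Local Notation L := (@iter_log R).

Lemma iter_log_nondecreasing k : \forall x \near +oo, forall y, x <= y -> L k x <= L k y.
Proof.
elim: k => [|k IH]; first by near=> x.
near=> x => y xy; have L1 : 1 <= L k x by near: x; exact: iter_log_large.
have h : L k x <= L k y by apply: (near IH x).
by rewrite !iter_logS ler_ln ?posrE //; lra.
Unshelve. all: by end_near. Qed.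

Lemma ln_sub_ge (a b : R) : 0 < a -> 0 < b -> (b - a) / b <= ln b - ln a.
Proof.
move=> a0 b0; have ab : 0 < a / b by rewrite divr_gt0.
have := expR_ge1Dx (ln (a / b)); rewrite lnK ?posrE // ln_div ?posrE //.
have -> : (b - a) / b = 1 - a / b by field; rewrite gt_eqF.
lra.
Qed.

(** A discrete form of [L_(k+1)' = log_prod k / x] with the right endpoint; each induction step uses
    [ln b - ln a >= (b - a) / b]. *)
Lemma iter_log_increment k : \forall x \near +oo,
  log_prod k (x + 1) / (x + 1) <= L k.+1 (x + 1) - L k.+1 x.
Proof.
elim: k => [|k IH].
  near=> x; have x0 : 0 < x by [].
  rewrite log_prod0; have := @ln_sub_ge x (x + 1) x0.
  by rewrite addrAC subrr add0r; apply; lra.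
near=> x.
have L1 : 1 <= L k.+1 x by near: x; exact: iter_log_large.
have h : L k.+1 x <= L k.+1 (x + 1).
  by apply: (near (iter_log_nondecreasing k.+1) x) => //; lra.
have L2 : 0 < L k.+1 (x + 1) by lra.
rewrite (iter_logS k.+1) (iter_logS k.+1 x).
apply: le_trans (ln_sub_ge _ L2); last lra.
by rewrite log_prodS mulrAC ler_wpM2r ?invr_ge0 ?(ltW L2) //; near: x.
Unshelve. all: by end_near. Qed.

Variables (d s : nat) (delta : R).
Hypothesis delta0 : 0 < delta.

Lemma radial_nonincreasing : \forall x \near +oo, forall y, x <= y ->
  radial d s delta y <= radial d s delta x.
Proof.
have sumle : \forall x \near +oo, forall y, x <= y ->
    \sum_(1 <= k < s.+1) L k.+1 x <= \sum_(1 <= k < s.+1) L k.+1 y.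
  elim: s => [|n IH]; first by near=> x => y _; rewrite !big_geq.
  near=> x => y xy; rewrite !(@big_nat_recr _ _ _ n.+1) //; apply: lerD.
    by apply: (near IH x).
  by apply: (near (iter_log_nondecreasing n.+2) x).
near=> x => y xy; rewrite /radial ler_expR lerN2.
apply: lerD; first apply: lerD.
- by rewrite ler_wpM2l ?divr_ge0 //; apply: (near (iter_log_nondecreasing 1) x).
- by rewrite ler_wpM2l //; apply: (near sumle x).
- by rewrite ler_wpM2l ?divr_ge0 ?(ltW delta0) //; apply: (near (iter_log_nondecreasing s.+1) x).
Unshelve. all: by end_near. Qed.

(** For large [x] this is [(log_s x)^(-delta)], whose decrements dominate the masses of the
    shells. *)
Definition log_decay x := expR (- (delta * L s.+1 x)).

Lemma radial_sqr : \forall x \near +oo,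
  radial d s delta x ^+ 2 = x ^- d * log_prod s x * log_decay x.
Proof.
have P : \forall x \near +oo, expR (- \sum_(1 <= k < s.+1) L k.+1 x) = log_prod s x.
  elim: s => [|n IH]; first by near=> x; rewrite big_geq // oppr0 expR0 log_prod0.
  near=> x; rewrite !(@big_nat_recr _ _ _ n.+1) // opprD expRD (near IH x) // log_prodS.
  have L1 : 1 <= L n.+1 x by near: x; exact: iter_log_large.
  by rewrite expRN (iter_logS n.+1) lnK // posrE; lra.
near=> x; have x0 : 0 < x by [].
rewrite -(near P x) // /log_decay.
have -> : x ^- d = expR (- (d%:R * L 1 x)).
  by rewrite expRN expRM_natl /iter_log /= lnK.
rewrite /radial expr2 -!expRD; congr expR; field.
Unshelve. all: by end_near. Qed.

(** By [radial_sqr], [x^d radial^2 = log_prod s * log_decay], which is [- x / delta] times the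
    derivative of [log_decay]. The discrete version combines [iter_log_increment] with
    [expR y >= 1 + y]. *)
Lemma radial_telescope : \forall x \near +oo,
  (x + 1) ^+ d * radial d s delta (x + 1) ^+ 2 <=
  (x + 1) * (delta^-1 * (log_decay x - log_decay (x + 1))).
Proof.
have [M [Mr HM]] := radial_sqr.
near=> x; have x0 : 0 < x by [].
have xM : M < x by near: x; apply: nbhs_pinfty_gt.
rewrite HM; last lra.
have -> : (x + 1) ^+ d * ((x + 1) ^- d * log_prod s (x + 1) * log_decay (x + 1)) =
    log_prod s (x + 1) * log_decay (x + 1).
  by field; rewrite expf_neq0 // gt_eqF //; lra.
have h : log_prod s (x + 1) / (x + 1) <= L s.+1 (x + 1) - L s.+1 x.
  by near: x; exact: iter_log_increment.
have g0 : 0 < log_decay (x + 1) by exact: expR_gt0.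
have e1 : delta * (L s.+1 (x + 1) - L s.+1 x) * log_decay (x + 1) <= log_decay x - log_decay (x + 1).
  have -> : log_decay x = log_decay (x + 1) * expR (delta * (L s.+1 (x + 1) - L s.+1 x)).
    by rewrite /log_decay -expRD; congr expR; ring.
  have := expR_ge1Dx (delta * (L s.+1 (x + 1) - L s.+1 x)).
  set y := delta * _ => hy.
  have : log_decay (x + 1) * (1 + y) <= log_decay (x + 1) * expR y by rewrite ler_pM2l.
  lra.
have e2 : delta * (log_prod s (x + 1) / (x + 1)) * log_decay (x + 1) <=
    log_decay x - log_decay (x + 1).
  by apply: le_trans e1; rewrite ler_wpM2r ?(ltW g0) // ler_wpM2l ?(ltW delta0).
have -> : log_prod s (x + 1) * log_decay (x + 1) = (x + 1) *
    (delta^-1 * (delta * (log_prod s (x + 1) / (x + 1)) * log_decay (x + 1))).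
  by field; rewrite !gt_eqF //; lra.
by rewrite ler_wpM2l ?ler_wpM2l ?invr_ge0 ?(ltW delta0) //; lra.
Unshelve. all: by end_near. Qed.

End RadialSummability.

(** * Lattice points in shells, and the supersolution on the lattice *)

Section LatticeSupersolution.
Variables (R : realType) (d : nat).
Implicit Types (n : lattice d) (N : nat).

Lemma enorm_outside_box n N : n \notin box d N -> N.+1%:R <= enorm R n.
Proof.
rewrite mem_box => /forallPn[j]; rewrite -ltNge => Ni.
have h : N.+1%:R <= (`|n ord0 j|%:~R : R).
  by rewrite -[N.+1%:R]/(N.+1%:Z%:~R) ler_int; move: Ni; move: `|n ord0 j| => z; lia.
apply: le_trans h _; rewrite intr_norm -sqrtr_sqr /enorm ler_wsqrtr //.
by rewrite (bigD1 j) //= lerDl sumr_ge0 // => k _; exact: sqr_ge0.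
Qed.

Lemma box_exhausts (X : R) : exists N, forall n, n \notin box d N -> X <= enorm R n.
Proof.
exists (Num.truncn X) => n /enorm_outside_box; apply: le_trans.
by apply/ltW/truncnS_gt.
Qed.

(** In the factorization of [a^d - b^d] with [a - b = 2], each of the [d] summands is at most
    [a^(d-1)], and [a = 2 N + 3 <= 3 (N + 1)]. *)
Lemma shell_size N : (size (box d N.+1))%:R - (size (box d N))%:R <=
  d%:R * 2 * (3 * N.+1%:R) ^+ d.-1 :> R.
Proof.
rewrite !size_box !natrX.
set a : R := (2 * N.+1).+1%:R; set b : R := (2 * N).+1%:R.
have ab : a = b + 2 by rewrite /a /b -natrD; congr _%:R; lia.
have b0 : 0 <= b by [].
have a3 : a <= 3 * N.+1%:R by rewrite /a -natrM ler_nat; lia.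
rewrite subrXX ab addrAC subrr add0r -ab [d%:R * 2]mulrC -mulrA ler_wpM2l //.
rewrite mulr_natl -[X in _ *+ X]card_ord -sumr_const; apply: ler_sum => i _.
have id : (i <= d.-1)%N by have := ltn_ord i; lia.
apply: (@le_trans _ _ (a ^+ (d.-1 - i) * a ^+ i)).
  by rewrite ler_wpM2l ?exprn_ge0 // ?lerXn2r ?nnegrE //; lra.
by rewrite -exprD subnK // lerXn2r ?nnegrE //; lra.
Qed.

Lemma box_shell_sum N (f : lattice d -> R) :
  \sum_(n <- box d N.+1) f n - \sum_(n <- box d N) f n =
  \sum_(n <- box d N.+1) (if n \in box d N then 0 else f n).
Proof.
have -> : \sum_(n <- box d N) f n = \sum_(n <- box d N.+1) (if n \in box d N then f n else 0).
  rewrite [LHS]big_seq -big_mkcond -[RHS]big_filter -[LHS]big_filter; apply: perm_big.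
  apply: uniq_perm; rewrite ?filter_uniq ?box_uniq // => n; rewrite !mem_filter.
  by have [nN|//] := boolP (n \in box d N); rewrite /= (box_sub (leqnSn N) nN).
by rewrite -sumrB; apply: eq_bigr => n _; case: ifP; rewrite ?subrr ?subr0.
Qed.

(** A point outside [box d N] has norm at least [N + 1], so monotonicity bounds [phi^2] on the next
    shell by its value at [N + 1]. Times the size of the shell, this is at most [K] times a
    decrement of [log_decay], and the decrements telescope. *)
Lemma bounded_radial (s : nat) (delta : R) : (0 < d)%N -> 0 < delta ->
  bounded_sums (fun n : lattice d => radial d s delta (enorm R n)).
Proof.
move=> d0 delta0; set phi := fun n => _.
have [M [_ HM]] := filterI (@radial_nonincreasing R d s delta delta0)
  (@radial_telescope R d s delta delta0).
pose g N := log_decay s delta (N%:R : R).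
pose K := d%:R * 2 * 3 ^+ d.-1 / delta.
have K0 : 0 <= K by rewrite divr_ge0 ?(ltW delta0) // mulr_ge0 ?exprn_ge0 // mulr_ge0.
have step N : M < N%:R -> dotp N.+1 phi phi - dotp N phi phi <= K * (g N - g N.+1).
  move=> MN; have N10 : 0 < N.+1%:R :> R by [].
  pose q := radial d s delta (N.+1%:R : R) ^+ 2.
  have q0 : 0 <= q by exact: sqr_ge0.
  have [_ tele] := HM _ MN.
  have MN1 : M < N.+1%:R by apply: lt_trans MN _; rewrite ltr_nat.
  have [mono _] := HM _ MN1.
  rewrite [X in X <= _]box_shell_sum.
  apply: (@le_trans _ _ (\sum_(n <- box d N.+1) (if n \in box d N then 0 else q))).
    apply: ler_sum => n _; case: ifPn => // nN; rewrite -expr2 /q.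
    by rewrite lerXn2r ?nnegrE ?expR_ge0 //; apply: mono; exact: enorm_outside_box.
  rewrite -box_shell_sum !big_const_seq !count_predT !iter_addr_0 -!(mulr_natl q) -mulrBl.
  apply: (@le_trans _ _ (d%:R * 2 * (3 * N.+1%:R) ^+ d.-1 * q)).
    by rewrite ler_wpM2r // shell_size.
  have : N.+1%:R ^+ d.-1 * q <= delta^-1 * (g N - g N.+1).
    move: tele; rewrite natr1 -/q -[X in _ ^+ X](prednK d0) exprS -mulrA ler_pM2l //.
  move=> h; rewrite exprMn.
  have -> : d%:R * 2 * (3 ^+ d.-1 * N.+1%:R ^+ d.-1) * q =
    d%:R * 2 * 3 ^+ d.-1 * (N.+1%:R ^+ d.-1 * q) by ring.
  by rewrite /K -[_ / delta * _]mulrA ler_wpM2l // ?mulr_ge0 // exprn_ge0.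
pose N0 := (Num.truncn M).+1.
have MN0 j : M < (N0 + j)%:R.
  by apply: lt_le_trans (truncnS_gt M) _; rewrite ler_nat leq_addr.
have tot j : dotp (N0 + j) phi phi <= dotp N0 phi phi + K * (g N0 - g (N0 + j)%N).
  elim: j => [|j IH]; first by rewrite addn0 subrr mulr0 addr0.
  by rewrite addnS; have := step _ (MN0 j); lra.
exists (dotp N0 phi phi + K * g N0) => N.
have [NN|NN] := leqP N0 N; last first.
  apply: (@le_trans _ _ (dotp N0 phi phi)); first by apply: dotp_norm_le; exact: ltnW.
  by rewrite lerDl mulr_ge0 // expR_ge0.
have := tot (N - N0)%N; rewrite subnKC // => /le_trans; apply.
by rewrite lerD2l ler_wpM2l // gerBl expR_ge0.
Qed.

Lemma enorm_sqr_step (n : lattice d) (i : 'I_d) (b : bool) :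
  enorm R (n + (if b then unit_vec i else - unit_vec i)) =
  Num.sqrt (enorm R n ^+ 2 + 1 + 2 * ((-1) ^+ (~~ b) * (n ord0 i)%:~R)).
Proof.
rewrite {1}/enorm enorm_sqr; congr Num.sqrt.
rewrite (bigD1 i) //= [in RHS](bigD1 i) //=.
rewrite [X in _ + X](_ : _ = \sum_(j < d | j != i) (n ord0 j)%:~R ^+ 2).
  by case: b; rewrite !mxE ?eqxx ?unit_vecE /= ?eqxx rmorphD ?rmorphN /= ?rmorph1; ring.
apply: eq_bigr => j /negbTE ji.
by case: b; rewrite !mxE ?unit_vecE /= ji ?oppr0 addr0.
Qed.

Lemma supersolution (V : lattice d -> R) (s : nat) (eps r : R) : (0 < d)%N -> 0 < eps ->
  (forall n, r <= enorm R n ->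
    d%:R * (4 - d%:R) / (4 * enorm R n ^+ 2)
    + 1 / enorm R n ^+ 2 * \sum_(1 <= j < s.+1) log_prod j (enorm R n)
    + eps / enorm R n ^+ 2 * log_prod s (enorm R n) <= V n) ->
  exists (phi : lattice d -> R) (N : nat), [/\ forall n, 0 < phi n, bounded_sums phi &
    forall n, n \notin box d N -> 0 <= ham V phi n].
Proof.
(* Both constraints of [log_sum_negligible] are met: [delta <= 1] and [2 delta <= eps]. *)
move=> d0 eps0 HV; pose delta := Num.min 1 (eps / 2).
have delta0 : 0 < delta by rewrite lt_min ltr01 divr_gt0.
have delta1 : delta <= 1 by rewrite ge_min lexx.
have delta2 : delta * 2 <= eps by rewrite -ler_pdivlMr // ge_min lexx orbT.
have [C HC] := radial_neighbour_sum d s delta.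
have d01 : 0 < delta <= 1 by rewrite delta0.
have [M [_ HM]] := filterI HC (@log_sum_negligible R s delta eps C d01 delta2).
have [N HN] := box_exhausts (Num.max (Num.max r 1) (M + 1)).
exists (fun n => radial d s delta (enorm R n)), N; split.
- by move=> n; exact: expR_gt0.
- exact: bounded_radial.
move=> n /HN; rewrite !ge_max => /andP[/andP[rn n1] nM].
set x := enorm R n in rn n1 nM *.
have x0 : 0 < x by lra.
have [] := HM x; first lra.
move=> /(_ (fun i => (n ord0 i)%:~R) (esym (enorm_sqr R n))) H1 H2.
have := HV n rn; rewrite -/x => Vn.
rewrite /ham subr_ge0.
have -> : neighbours (fun m => radial d s delta (enorm R m)) n =
    \sum_i (radial d s delta (Num.sqrt (x ^+ 2 + 1 + 2 * (n ord0 i)%:~R)) +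
            radial d s delta (Num.sqrt (x ^+ 2 + 1 - 2 * (n ord0 i)%:~R))).
  apply: eq_bigr => i _; have := enorm_sqr_step n i true; have := enorm_sqr_step n i false.
  by rewrite /= expr0 expr1 mul1r mulN1r mulrN => -> ->.
apply: le_trans H1 _; rewrite mulrC ler_wpM2r ?expR_ge0 // lerD2l.
(* The leading terms agree with the bound on [V] except that [delta] replaces [eps]; the difference
   [(eps - delta) * log_prod s x] covers the rest by [H2]. *)
apply: le_trans Vn; rewrite drift_diffusion.
have -> : d%:R * (4 - d%:R) / (4 * x ^+ 2) + 1 / x ^+ 2 * \sum_(1 <= j < s.+1) log_prod j x
    + eps / x ^+ 2 * log_prod s x =
    (d%:R * (4 - d%:R) / 4 + \sum_(1 <= j < s.+1) log_prod j x + eps * log_prod s x) / x ^+ 2.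
  by field; rewrite gt_eqF.
rewrite ler_wpM2r ?invr_ge0 ?exprn_ge0 ?(ltW x0) //.
have : log_sum s delta x = \sum_(1 <= j < s.+1) log_prod j x + delta * log_prod s x by [].
lra.
Qed.

(** Outside the box, [(2 d + V) phi >= neighbours phi >= 0] with [phi > 0] gives [V >= - 2 d];
    inside there are finitely many values. *)
Lemma bounded_below (V phi : lattice d -> R) (N : nat) : (forall n, 0 < phi n) ->
  (forall n, n \notin box d N -> 0 <= ham V phi n) -> exists M : R, forall n, M <= V n.
Proof.
move=> phi0 H; exists (- (2 * d%:R + \sum_(n <- box d N) `|V n|)) => n.
have S0 : 0 <= \sum_(n <- box d N) `|V n| by exact: sumr_ge0.
have [nN|nN] := boolP (n \in box d N).
  have : `|V n| <= \sum_(n <- box d N) `|V n| by rewrite (big_rem n) //= lerDl sumr_ge0.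
  have := ler_norm (- V n); rewrite normrN; have : 0 <= d%:R :> R by [].
  lra.
have := H n nN; rewrite /ham subr_ge0 => h.
have : 0 <= (2 * d%:R + V n) * phi n.
  by apply: le_trans h; apply: sumr_ge0 => i _; rewrite addr_ge0 // ltW.
rewrite pmulr_lge0 //; lra.
Qed.
End LatticeSupersolution.

Theorem theorem2 (R : realType) (d : nat) (d_gt0 : (0 < d)%N)
    (V : lattice d -> R)
    (inf_spec : real_inf (spectrum (schroedinger V)) = 0%:E)
    (inf_ess : real_inf (essential_spectrum (schroedinger V)) = 0%:E)
    (crit : critical_at V 0)
    (lower_bound : exists (s : nat) (eps : R), 0 < eps /\
      exists r : R, forall n : lattice d, r <= enorm R n ->
        d%:R * (4 - d%:R) / (4 * enorm R n ^+ 2)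
        + 1 / enorm R n ^+ 2 *
            \sum_(1 <= j < s.+1) \prod_(1 <= k < j.+1) (1 / iter_log k (enorm R n))
        + eps / enorm R n ^+ 2 *
            \prod_(1 <= k < s.+1) (1 / iter_log k (enorm R n))
        <= V n) :
  point_spectrum (schroedinger V) 0.
Proof.
have [s [eps [eps0 [r HV]]]] := lower_bound.
have [phi [N [phi0 bphi Hphi]]] := supersolution d_gt0 eps0 HV.
have [M MV] := bounded_below phi0 Hphi.
have [V0 nV] := critical_form MV crit.
have [psi [bpsi [m psim] Hpsi]] := ground_state phi0 bphi Hphi V0 nV.
have z0 : ham V (fun=> 0) =1 fun=> 0.
  by move=> n; rewrite /ham mulr0 sub0r /neighbours big1 ?oppr0 // => i _; rewrite addr0.
exists (mk_wave psi (fun=> 0)); split; last first.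
  by move/funeqP/(_ m) => -[] /eqP; rewrite (negbTE psim).
split=> [|n]; last by rewrite schroedinger_act Hpsi z0 mul0r.
have b0 := bounded_sums0 R d.
by apply: dom_schroedinger => //; rewrite (_ : ham V _ = fun=> 0) //; apply/funext.
Qed.
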